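(* Let $\Lambda=\Lambda(n,2)$ admit a $d$-cluster tilting subcategory $\mathcal C\subseteq\operatorname{mod}\Lambda$ (so $l=2$). Then the assignment $\chi\mapsto\mathcal U(\chi)$ is a bijection from the set of directed paths $\chi$ of length $p-1$ in the multigraph $G$ to the set of $d$-torsion classes $\mathcal U$ in $\mathcal C$.
   Context: **Algebra and $d$-cluster tilting subcategory.** Fix a field $\mathbf k$ and integers $n\ge 1$, $d\ge 2$. $[a,b]$ denotes the set of integers $z$ with $a\le z\le b$ (empty if $a>b$). $\Lambda=\Lambda(n,2)=\mathbf kQ/J^2$, where $Q$ is the quiver $n\to n-1\to\cdots\to 2\to 1$ and $J$ is the arrow ideal. $\operatorname{mod}\Lambda$ is the category of finitely generated right modules. Subcategories are full, additive and closed under isomorphisms. $S(k)$ is the simple module at $k$; for $1\le k\le n-1$, $I(k)$ is the indecomposable injective (and projective) module with socle $S(k)$ and top $S(k+1)$; for $K\subseteq[1,n]$, $I(K)=\bigoplus_{k\in K}I(k)$. A functorially finite subcategory $\mathcal C$ is $d$-cluster tilting if $\mathcal C=\{M:\operatorname{Ext}^i_\Lambda(M,\mathcal C)=0,\ 1\le i\le d-1\}=\{M:\operatorname{Ext}^i_\Lambda(\mathcal C,M)=0,\ 1\le i\le d-1\}$. Known: $\Lambda(n,2)$ admits a $d$-cluster tilting subcategory iff $n=(p-1)d+1$ for some integer $p\ge1$; with $s_i=(i-1)d+1$ for $1\le i\le p$ and $\mathcal D_i=\operatorname{add}S(s_i)$, it is then $\mathcal C=\operatorname{add}(\Lambda\oplus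 S(s_1)\oplus\cdots\oplus S(s_p))$. **$d$-torsion classes.** In $\mathcal C$, $g:B\to C$ is a weak cokernel of $f:A\to B$ if $gf=0$ and every $h:B\to D$ with $hf=0$ factors through $g$. A $d$-cokernel of $f_0:A_0\to A_1$ is a sequence $A_1\xrightarrow{f_1}\cdots\xrightarrow{f_d}A_{d+1}$ with $f_i$ a weak cokernel of $f_{i-1}$ for $1\le i\le d-1$ and $f_d$ a cokernel of $f_{d-1}$; $d$-kernels are dual. A sequence $0\to A_0\xrightarrow{f_0}A_1\to\cdots\to A_d\xrightarrow{f_d}A_{d+1}\to0$ is a $d$-extension if $(f_1,\dots,f_d)$ is a $d$-cokernel of $f_0$ and $(f_0,\dots,f_{d-1})$ is a $d$-kernel of $f_d$. A subcategory $\mathcal U\subseteq\mathcal C$ is a $d$-torsion class if for every $C\in\mathcal C$ there is a $d$-extension $0\to U\to C\to C_1\to\cdots\to C_d\to0$ in $\mathcal C$ with $U\in\mathcal U$ such that for every $U'\in\mathcal U$ the sequence $0\to\operatorname{Hom}_\Lambda(U',C_1)\to\cdots\to\operatorname{Hom}_\Lambda(U',C_d)\to0$ is exact. **The multigraph $G$.** Two vertices $\mathcal D^\downarrow(0)$ and $\mathcal D$; arrows $\gamma:\mathcal D^\downarrow(0)\to\mathcal D^\downarrow(0)$, $\epsilon:\mathcal D\to\mathcal D$, $\beta:\mathcal D\to\mathcal D^\downarrow(0)$ and $\delta_y:\mathcal D^\downarrow(0)\to\mathcal D$ for $0\le y\le d$. **The subcategory $\mathcal U(\chi)$.** Let $\chi$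 be a path with successive arrows $\chi_1,\dots,\chi_{p-1}$ (the end of $\chi_i$ is the start of $\chi_{i+1}$) and successive vertices $v_1,\dots,v_p$ (a path of length $0$ is a vertex). Put $\mathcal U_i(\chi)=0$ if $v_i=\mathcal D^\downarrow(0)$ and $\mathcal U_i(\chi)=\mathcal D_i$ if $v_i=\mathcal D$. With $F_i=[s_i,s_{i+1}-1]$, $1\le i\le p-1$ (a partition of $[1,n-1]$), define $Q_{\mathcal U(\chi)}\subseteq[1,n-1]$ by: $Q_{\mathcal U(\chi)}\cap F_i=\varnothing$ if $\chi_i\in\{\beta,\gamma\}$; $Q_{\mathcal U(\chi)}\cap F_i=[s_{i+1}-y,s_{i+1}-1]$ if $\chi_i=\delta_y$; $Q_{\mathcal U(\chi)}\cap F_i=F_i$ if $\chi_i=\epsilon$. Then $\mathcal U(\chi)=\operatorname{add}(\mathcal U_1(\chi),\dots,\mathcal U_p(\chi),I(Q_{\mathcal U(\chi)}))$. *)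

(* Defs.v *)
From HB Require Import structures.
From mathcomp Require Import all_boot all_algebra.

Set Implicit Arguments.
Unset Strict Implicit.
Unset Printing Implicit Defensive.

Import GRing.Theory.
Local Open Scope ring_scope.

Record quiver := Quiver {
  vertex : finType;
  arrow : finType;
  src : arrow -> vertex;
  tgt : arrow -> vertex }.

(* k Q / J^2.  As J^2 is spanned by the paths of length at least 2, the       *)
(* classes of the trivial paths e_i (coordinate inl i) and of the arrows a    *)
(* (coordinate inr a) form a basis.  Paths compose from left to right, i.e.,  *)
(* a = e_(src a) * a * e_(tgt a), so that a right module V is a               *)
(* representation with a acting as V e_(src a) -> V e_(tgt a).                *)
Definition rad2 (F : fieldType) (Q : quiver) : Type :=
  {ffun vertex Q + arrow Q -> F}.

Section Rad2.
Variables (F : fieldType) (Q : quiver).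
Local Notation A := (rad2 F Q).

HB.instance Definition _ :=
  GRing.Zmodule.copy A {ffun vertex Q + arrow Q -> F}.

Definition rad2_one : A :=
  [ffun p => match p with inl _ => 1 | inr _ => 0 end].

Definition rad2_mul (x y : A) : A :=
  [ffun p => match p with
             | inl i => x (inl i) * y (inl i)
             | inr a => x (inl (src a)) * y (inr a)
                        + x (inr a) * y (inl (tgt a))
             end].

Lemma rad2_mulA : associative rad2_mul.
Proof.
move=> x y z; apply/ffunP => -[i|a]; rewrite !ffunE ?mulrA //.
by rewrite mulrDr mulrDl !mulrA addrA.
Qed.

Lemma rad2_mul1 : left_id rad2_one rad2_mul.
Proof.
by move=> x; apply/ffunP => -[i|a]; rewrite !ffunE ?mul1r // mul0r addr0.
Qed.

Lemma rad2_mulr1 : right_id rad2_one rad2_mul.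
Proof.
by move=> x; apply/ffunP => -[i|a]; rewrite !ffunE ?mulr1 // mulr0 add0r.
Qed.

Lemma rad2_mulDl : left_distributive rad2_mul +%R.
Proof.
move=> x y z; apply/ffunP => -[i|a]; rewrite !ffunE ?mulrDl //.
by rewrite addrACA.
Qed.

Lemma rad2_mulDr : right_distributive rad2_mul +%R.
Proof.
move=> x y z; apply/ffunP => -[i|a]; rewrite !ffunE ?mulrDr //.
by rewrite addrACA.
Qed.

HB.instance Definition _ := GRing.Zmodule_isPzRing.Build A
  rad2_mulA rad2_mul1 rad2_mulr1 rad2_mulDl rad2_mulDr.

End Rad2.

(* The quiver n -> n-1 -> ... -> 2 -> 1.  Indices are shifted by one: the     *)
(* ordinal i : 'I_n stands for the vertex i+1 of [1, n], and k : 'I_n.-1      *)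
(* for k+1 in [1, n-1], seen as the arrow k+2 -> k+1.                         *)
Fact hi_proof n (k : 'I_n.-1) : (k.+1 < n)%N.
Proof. by case: n k => [|n] []. Qed.

Fact lo_proof n (k : 'I_n.-1) : (k < n)%N.
Proof. exact: ltn_trans (ltnSn k) (hi_proof k). Qed.

Definition hi n (k : 'I_n.-1) : 'I_n := Ordinal (hi_proof k).
Definition lo n (k : 'I_n.-1) : 'I_n := Ordinal (lo_proof k).

Definition linear_quiver (n : nat) : quiver := Quiver (@hi n) (@lo n).

Definition Lambda (F : fieldType) (n : nat) : pzRingType :=
  rad2 F (linear_quiver n).

(* Right R-modules are left modules over the converse ring R^c, so a *: x is  *)
(* x a.  For R = Lambda F n the F-linearity of morphisms is automatic.        *)
Notation rmodType R := (lmodType (R%type : pzRingType)^c).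

(* Full subcategories of the module category, as classes of objects.          *)
Definition modclass (R : pzRingType) : Type := rmodType R -> Prop.

Section Modules.
Variable R : pzRingType.
Implicit Types M N P X : rmodType R.

Definition finitely_generated M : Prop :=
  exists (m : nat) (g : 'I_m -> M), forall x : M,
    exists c : 'I_m -> R^c, x = \sum_i c i *: g i.

Definition isomorphic M N : Prop :=
  exists f : {linear M -> N}, bijective f.

Definition zero_module M : Prop := forall x : M, x = 0.

Definition direct_sum (I : Type) (s : seq I) (X_ : I -> rmodType R) :
    rmodType R :=
  foldr (fun i N => (X_ i * N)%type : rmodType R) 'rV[R^c]_0 s.

(* The class of direct summands of finite direct sums of members of XX.       *)
Definition add (XX : modclass R) : modclass R :=
  fun M => exists (m : nat) (X_ : 'I_m -> rmodType R) N,
    (forall i, XX (X_ i)) /\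
    isomorphic (M * N)%type (direct_sum (enum 'I_m) X_).

Record subcategory (CC : modclass R) : Prop := Subcategory {
  subcat_fg : forall M, CC M -> finitely_generated M;
  subcat_iso : forall M N, isomorphic M N -> CC M -> CC N;
  subcat_zero : forall M, zero_module M -> CC M;
  subcat_sum : forall M N, CC M -> CC N -> CC (M * N)%type }.

Definition functorially_finite (CC : modclass R) : Prop :=
  forall M, finitely_generated M ->
    (exists2 X, CC X & exists f : {linear X -> M},
       forall X', CC X' -> forall g : {linear X' -> M},
         exists h : {linear X' -> X}, g =1 f \o h) /\
    (exists2 X, CC X & exists f : {linear M -> X},
       forall X', CC X' -> forall g : {linear M -> X'},
         exists h : {linear X -> X'}, g =1 h \o f).

Definition projective P : Prop :=
  forall M N (g : {linear M -> N}) (f : {linear P -> N}),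
    (forall y, exists x, g x = y) ->
    exists h : {linear P -> M}, f =1 g \o h.

Record proj_resolution M := ProjResolution {
  res_obj : nat -> rmodType R;
  res_diff : forall i, {linear res_obj i.+1 -> res_obj i};
  res_aug : {linear res_obj 0 -> M};
  res_proj : forall i, projective (res_obj i);
  res_surj : forall x, exists y, res_aug y = x;
  res_exact0 : forall y, res_aug y = 0 <-> exists z, res_diff 0 z = y;
  res_exact : forall i y,
    res_diff i y = 0 <-> exists z, res_diff i.+1 z = y }.

(* Ext^i(M, N) = 0: the i-th cohomology of Hom(P, N) vanishes for the         *)
(* projective resolutions P of M.                                             *)
Definition Ext_vanishes (i : nat) M N : Prop :=
  forall P : proj_resolution M,
    match i with
    | 0 => forall f : {linear res_obj P 0 -> N},
        (forall x, f (res_diff P 0 x) = 0) -> forall y, f y = 0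
    | j.+1 => forall f : {linear res_obj P j.+1 -> N},
        (forall x, f (res_diff P j.+1 x) = 0) ->
        exists g : {linear res_obj P j -> N}, f =1 g \o res_diff P j
    end.

Definition cluster_tilting (d : nat) (CC : modclass R) : Prop :=
  [/\ subcategory CC, functorially_finite CC,
      forall M, CC M <-> finitely_generated M /\
        forall i, (1 <= i <= d.-1)%N -> forall N, CC N -> Ext_vanishes i M N
    & forall M, CC M <-> finitely_generated M /\
        forall i, (1 <= i <= d.-1)%N -> forall N, CC N -> Ext_vanishes i N M].

Section HigherExact.
Variable CC : modclass R.

Definition weak_cokernel (A B C : rmodType R)
    (f : {linear A -> B}) (g : {linear B -> C}) : Prop :=
  (forall x, g (f x) = 0) /\
  forall D, CC D -> forall h : {linear B -> D}, (forall x, h (f x) = 0) ->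
    exists h' : {linear C -> D}, h =1 h' \o g.

Definition cokernel (A B C : rmodType R)
    (f : {linear A -> B}) (g : {linear B -> C}) : Prop :=
  weak_cokernel f g /\
  forall D, CC D -> forall h1 h2 : {linear C -> D},
    h1 \o g =1 h2 \o g -> h1 =1 h2.

Definition weak_kernel (A B C : rmodType R)
    (f : {linear A -> B}) (g : {linear B -> C}) : Prop :=
  (forall x, g (f x) = 0) /\
  forall D, CC D -> forall h : {linear D -> B}, (forall x, g (h x) = 0) ->
    exists h' : {linear D -> A}, h =1 f \o h'.

Definition kernel (A B C : rmodType R)
    (f : {linear A -> B}) (g : {linear B -> C}) : Prop :=
  weak_kernel f g /\
  forall D, CC D -> forall h1 h2 : {linear D -> A},
    f \o h1 =1 f \o h2 -> h1 =1 h2.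

(* A sequence A_0 -> A_1 -> ... -> A_(d+1) is given by infinite families of   *)
(* which only A 0, ..., A d.+1 and f 0, ..., f d matter.                      *)
Variables (d : nat) (A : nat -> rmodType R).
Variable f : forall i, {linear A i -> A i.+1}.

Definition d_cokernel : Prop :=
  (forall i, (i.+1 < d)%N -> weak_cokernel (f i) (f i.+1)) /\
  (forall i, i.+1 = d -> cokernel (f i) (f i.+1)).

Definition d_kernel : Prop :=
  kernel (f 0) (f 1) /\
  (forall i, (0 < i)%N -> (i < d)%N -> weak_kernel (f i) (f i.+1)).

Definition d_extension : Prop :=
  [/\ forall i, (i <= d.+1)%N -> CC (A i), d_cokernel & d_kernel].

(* Exactness of 0 -> Hom(U, A_2) -> ... -> Hom(U, A_(d+1)) -> 0.              *)
Definition Hom_exact (U : rmodType R) : Prop :=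
  [/\ (forall h : {linear U -> A 2}, (forall x, f 2 (h x) = 0) ->
         forall x, h x = 0),
      (forall i, (2 <= i)%N -> (i < d)%N -> forall h : {linear U -> A i.+1},
         (forall x, f i.+1 (h x) = 0) <->
         exists g : {linear U -> A i}, h =1 f i \o g)
    & (forall h : {linear U -> A d.+1},
         exists g : {linear U -> A d}, h =1 f d \o g)].

End HigherExact.

Definition d_torsion (d : nat) (CC UU : modclass R) : Prop :=
  [/\ subcategory UU, forall M, UU M -> CC M
    & forall C, CC C ->
        exists (A : nat -> rmodType R) (f : forall i, {linear A i -> A i.+1}),
          [/\ d_extension CC d f, UU (A 0), A 1 = C
            & forall U, UU U -> Hom_exact d f U]].

End Modules.

Definition S_carrier (F : fieldType) (n : nat) (i : 'I_n) : Type := F.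

Section SMod.
Variables (F : fieldType) (n : nat) (i : 'I_n).
Local Notation L := (Lambda F n).
Local Notation V := (S_carrier F i).

HB.instance Definition _ := GRing.Zmodule.copy V F.

Definition S_act (a : L^c) (v : V) : V := (v : F) * (a : rad2 _ _) (inl i).

Fact S_actA a b v : S_act a (S_act b v) = S_act (a * b) v.
Proof. by rewrite /S_act ffunE mulrA. Qed.
Fact S_act1 : left_id 1 S_act.
Proof. by move=> v; rewrite /S_act ffunE mulr1. Qed.
Fact S_actDr : right_distributive S_act +%R.
Proof. by move=> a u v; rewrite /S_act mulrDl. Qed.
Fact S_actDl v : {morph S_act^~ v : a b / a + b}.
Proof. by move=> a b; rewrite /S_act ffunE mulrDr. Qed.

HB.instance Definition _ :=
  GRing.Zmodule_isLmodule.Build L^c V S_actA S_act1 S_actDr S_actDl.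
End SMod.

Definition Smod (F : fieldType) (n : nat) (i : 'I_n) : rmodType (Lambda F n) :=
  S_carrier F i.

(* (x, y) stands for x u + y w, where u spans the top, at hi k, w spans the   *)
(* socle, at lo k, and the arrow k maps u to w.                               *)
Definition I_carrier (F : fieldType) (n : nat) (k : 'I_n.-1) : Type := (F * F)%type.

Section IMod.
Variables (F : fieldType) (n : nat) (k : 'I_n.-1).
Local Notation L := (Lambda F n).
Local Notation V := (I_carrier F k).

HB.instance Definition _ := GRing.Zmodule.copy V (F * F)%type.

Definition I_act (a : L^c) (v : V) : V :=
  let c : rad2 F (linear_quiver n) := a in
  (v.1 * c (inl (hi k)), v.1 * c (inr k) + v.2 * c (inl (lo k))).

Fact I_actA a b v : I_act a (I_act b v) = I_act (a * b) v.
Proof.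
rewrite /I_act !ffunE /=; congr pair; first by rewrite mulrA.
by rewrite mulrDr mulrDl !mulrA addrA.
Qed.
Fact I_act1 : left_id 1 I_act.
Proof. by case=> x y; rewrite /I_act !ffunE /= !mulr1 mulr0 add0r. Qed.
Fact I_actDr : right_distributive I_act +%R.
Proof.
by move=> a [x y] [z t]; rewrite /I_act /= !mulrDl; congr pair; rewrite addrACA.
Qed.
Fact I_actDl v : {morph I_act^~ v : a b / a + b}.
Proof.
by move=> a b; rewrite /I_act !ffunE !mulrDr; congr pair; rewrite addrACA.
Qed.

HB.instance Definition _ :=
  GRing.Zmodule_isLmodule.Build L^c V I_actA I_act1 I_actDr I_actDl.
End IMod.

Definition Imod (F : fieldType) (n : nat) (k : 'I_n.-1) : rmodType (Lambda F n) :=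
  I_carrier F k.

Definition Imod_sum (F : fieldType) (n : nat) (K : {set 'I_n.-1}) :
    rmodType (Lambda F n) :=
  direct_sum (enum K) (@Imod F n).

Inductive Gvertex := Ddown0 | DD.

Inductive Garrow (d : nat) :=
  Gamma | Epsilon | Beta | Delta (y : nat) of (y <= d)%N.

Definition Gsrc d (a : Garrow d) : Gvertex :=
  match a with
  | Gamma => Ddown0 | Epsilon => DD | Beta => DD | Delta _ _ => Ddown0
  end.

Definition Gtgt d (a : Garrow d) : Gvertex :=
  match a with
  | Gamma => Ddown0 | Epsilon => DD | Beta => Ddown0 | Delta _ _ => DD
  end.

(* Candidate paths of length p-1 (p >= 1), as their p successive vertices and *)
(* p-1 successive arrows; the arrow j goes from the vertex lo j = j to the    *)
(* vertex hi j = j+1.                                                         *)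
Definition Gwalk (d p : nat) : Type :=
  ({ffun 'I_p -> Gvertex} * {ffun 'I_p.-1 -> Garrow d})%type.

Definition Gpath d p (chi : Gwalk d p) : Prop :=
  forall j : 'I_p.-1,
    Gsrc (chi.2 j) = chi.1 (lo j) /\ Gtgt (chi.2 j) = chi.1 (hi j).

Section Uchi.
Variables (F : fieldType) (n d p : nat).

(* With vertices shifted by one, s_ i = s_(i+1) - 1.                          *)
Definition s_ (i : nat) : nat := (i * d)%N.

Definition D_ (i : 'I_p) : modclass (Lambda F n) :=
  add (fun M => exists2 j : 'I_n, j = s_ i :> nat & M = Smod F j).

Definition U_ (chi : Gwalk d p) (i : 'I_p) : modclass (Lambda F n) :=
  match chi.1 i with Ddown0 => @zero_module _ | DD => D_ i end.

(* k+1 lies in the intersection of Q_U(chi) with the block F_(j+1).           *)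
Definition inQ (chi : Gwalk d p) (j : 'I_p.-1) (k : nat) : bool :=
  match chi.2 j with
  | Beta | Gamma => false
  | Delta y _ => (s_ j.+1 - y <= k < s_ j.+1)%N
  | Epsilon => (s_ j <= k < s_ j.+1)%N
  end.

Definition Q_ (chi : Gwalk d p) : {set 'I_n.-1} :=
  [set k : 'I_n.-1 | [exists j : 'I_p.-1, inQ chi j k]].

Definition U_of (chi : Gwalk d p) : modclass (Lambda F n) :=
  add (fun M => (exists i, U_ chi i M) \/ M = Imod_sum F (Q_ chi)).

End Uchi.

Arguments U_of F n {d p} chi _.

(* Main.v *)
From HB Require Import structures.
From mathcomp Require Import all_boot all_algebra zify.
From Stdlib Require Import Classical_Prop Classical_Pred_Type.
Require Import Defs.

(* With vertices numbered from 0, a module [N] over [Lambda F n] is a complex of *)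
(* vector spaces, and [Ext^r (S m, N)] is its homology at the vertex [m - r] for *)
(* [r > 0].  Starting from the projective module [S 0], this forces the simples  *)
(* in a [d]-cluster tilting subcategory to be those at the multiples of [d], and *)
(* its members to be exact at every other vertex; splitting off simples and      *)
(* projective-injectives, they are sums of such [S (j d)] and of [I k]'s.        *)
(* Up to isomorphism a torsion class is then the set of indecomposables it       *)
(* contains.  Its torsion sequences give three closure conditions:               *)
(*   - if [I k] is in it and [k+1 = j d], so is the quotient [S (j d)];          *)
(*   - if [I k] is in it and [d] does not divide [k+1], so is [I (k+1)], since   *)
(*     the torsion part of [I (k+1)] is exact at [k+1];                          *)
(*   - if [S (j d)] and [S ((j+1) d)] are in it, so is [I (j d)]: otherwise      *)
(*     [S (j d) -> I (j d) -> ... -> S ((j+1) d)] would be its torsion sequence. *)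
(* These conditions say exactly that the set comes from a path in the multigraph.*)
(* Conversely, under them each indecomposable of the subcategory is torsion, is  *)
(* torsion free, or is [I (j d)] with the sequence above as torsion sequence.    *)

(** The syzygy of a simple module is the simple one vertex lower, so [Ext_S] turns each vanishing of
    Ext out of a simple into exactness at one vertex. Hence [ct_S] and [ct_exact], and [module_ind]
    reduces questions about the subcategory to the modules [Smod] and [Imod].

    A torsion class is closed under summands and under quotients lying in the subcategory
    ([tor_retract], [tor_quotient]), so two finite data determine it: the multiples of [d] whose
    simple it contains, and the set of its [Imod]'s. The predicate [is_profile] packs the three
    closure conditions; [tor_top], [tor_step] and [tor_socle] derive them, while [path_profile] and
    [profile_path] identify such data with paths. The hardest condition is [tor_socle]: the chase
    [ext_correct] moves a generator of [Imod] into the kernel of the second map of its torsion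
    sequence.

    Both data can be read off [U_of] ([U_S_inv], [U_I_inv]), because exactness at a vertex and being
    killed by an arrow pass to sums and summands; with [path_inj] this gives injectivity. In the
    converse direction, [path_torsion] uses sequences whose terms from the third on receive no
    nonzero map from the class, so the Hom sequences are zero. *)

Set Implicit Arguments.
Unset Strict Implicit.
Unset Printing Implicit Defensive.

Import GRing.Theory.
Local Open Scope ring_scope.

(** * Linear algebra *)

Section LinearOfFun.
Variables (R : pzRingType) (U V : lmodType R) (f : U -> V) (fL : linear f).

Definition mklin_fun : U -> V := f.
HB.instance Definition _ := GRing.isLinear.Build R U V *:%R mklin_fun fL.
Definition mklin : {linear U -> V} := mklin_fun.

End LinearOfFun.

Section KernelModule.
Variables (R : pzRingType) (M N : lmodType R) (f : {linear M -> N}).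

Definition ker_pred : pred M := fun x => f x == 0.

Fact ker_pred_closed : submod_closed ker_pred.
Proof.
split=> [|a x y]; rewrite !unfold_in /= ?linear0 // /ker_pred.
by move=> /eqP fx /eqP fy; rewrite linearP fx fy scaler0 addr0.
Qed.

HB.instance Definition _ :=
  GRing.isSubmodClosed.Build R M ker_pred ker_pred_closed.

Record ker_mod := KerMod { ker_val : M; _ : ker_pred ker_val }.

HB.instance Definition _ := [isSub for ker_val].
HB.instance Definition _ := [Choice of ker_mod by <:].
HB.instance Definition _ := [SubChoice_isSubLmodule of ker_mod by <:].

Definition ker_incl : {linear ker_mod -> M} := val.

Lemma ker_inclK x : f (ker_incl x) = 0.
Proof. by apply/eqP; case: x. Qed.

Lemma ker_lift (L : lmodType R) (g : {linear L -> M}) :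
  (forall x, f (g x) = 0) ->
  exists h : {linear L -> ker_mod}, forall x, ker_incl (h x) = g x.
Proof.
move=> fg0.
have fg x : ker_pred (g x) by rewrite /ker_pred fg0.
have hL : linear (fun x => KerMod (fg x)).
  move=> a x y; apply: val_inj; apply: etrans (linearP g a x y) _.
  exact/esym/(linearP ker_incl).
by exists (mklin hL).
Qed.

End KernelModule.

Section LinearMaps.
Variable R : pzRingType.
Implicit Types M N X Y Z W : lmodType R.

(** A section of [r] comes from [xchoose]; two preimages differ by an element that [f] kills, so [f]
    after the section is linear. *)
Lemma lin_factor X Y Z (r : {linear X -> Y}) (f : {linear X -> Z}) :
  (forall y, exists x, r x = y) -> (forall x, r x = 0 -> f x = 0) ->
  exists g : {linear Y -> Z}, forall x, f x = g (r x).
Proof.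
move=> r_surj rf.
have rs y : exists x, r x == y by have [x <-] := r_surj y; exists x.
pose s y := xchoose (rs y).
have sK y : r (s y) = y by apply/eqP/(xchooseP (rs y)).
have f_eq x x' : r x = r x' -> f x = f x'.
  by move=> e; apply/eqP; rewrite -subr_eq0 -linearB rf // linearB e subrr.
have gL : linear (fun y => f (s y)).
  by move=> a y y' /=; rewrite -linearP; apply: f_eq; rewrite linearP !sK.
by exists (mklin gL) => x; apply: f_eq; rewrite sK.
Qed.

Lemma fst_linear X Y : linear (fst : X * Y -> X). Proof. by []. Qed.
Lemma snd_linear X Y : linear (snd : X * Y -> Y). Proof. by []. Qed.
Lemma inl_linear X Y : linear ((fun x => (x, 0)) : X -> X * Y).
Proof. by move=> a x y; congr pair => //=; rewrite scaler0 addr0. Qed.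
Lemma inr_linear X Y : linear ((fun y => (0, y)) : Y -> X * Y).
Proof. by move=> a x y; congr pair => //=; rewrite scaler0 addr0. Qed.
Lemma pair_linear X Y Z (f : {linear X -> Y}) (g : {linear X -> Z}) :
  linear (fun x => (f x, g x)).
Proof. by move=> a x y; rewrite !linearP. Qed.
Lemma map_pair_linear X Y Z W (f : {linear X -> Y}) (g : {linear Z -> W}) :
  linear (fun x : X * Z => (f x.1, g x.2)).
Proof. by move=> a [x z] [x' z']; rewrite !linearP. Qed.

End LinearMaps.

Definition lfst R X Y := mklin (@fst_linear R X Y).
Definition lsnd R X Y := mklin (@snd_linear R X Y).
Definition linl R X Y := mklin (@inl_linear R X Y).
Definition linr R X Y := mklin (@inr_linear R X Y).
Arguments lfst {R}.
Arguments lsnd {R}.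
Arguments linl {R}.
Arguments linr {R}.

Lemma iso_inv (R : pzRingType) (M N : rmodType R) :
  isomorphic M N ->
  exists (f : {linear M -> N}) (g : {linear N -> M}), cancel f g /\ cancel g f.
Proof.
case=> f [g fK gK]; exists f, (mklin (can2_linear fK gK)).
by split.
Qed.

Lemma isoI (R : pzRingType) (M N : rmodType R)
    (f : {linear M -> N}) (g : {linear N -> M}) :
  cancel f g -> cancel g f -> isomorphic M N.
Proof. by move=> fK gK; exists f; exists g. Qed.

Lemma iso_refl (R : pzRingType) (M : rmodType R) : isomorphic M M.
Proof. exact: (@isoI _ _ _ idfun idfun). Qed.

Lemma iso_sym (R : pzRingType) (M N : rmodType R) :
  isomorphic M N -> isomorphic N M.
Proof. by move=> /iso_inv[f [g [fK gK]]]; exists g; exists f. Qed.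

Lemma iso_trans (R : pzRingType) (M N P : rmodType R) :
  isomorphic M N -> isomorphic N P -> isomorphic M P.
Proof.
by move=> [f fb] [g gb]; exists (g \o f); exact: bij_comp.
Qed.

Lemma retract_iso (R : pzRingType) (M X : rmodType R)
    (s : {linear X -> M}) (r : {linear M -> X}) :
  cancel s r -> isomorphic (X * ker_mod r)%type M.
Proof.
move=> sK; pose g : {linear M -> M} := idfun \- (s \o r).
have [|t tE] := @ker_lift _ _ _ r _ g.
  by move=> x; rewrite /g /= linearB /= sK subrr.
have fL : linear (fun v : X * ker_mod r => s v.1 + ker_incl r v.2).
  by move=> a [x k] [x' k']; rewrite /= !linearP scalerDr addrACA.
apply: (@isoI _ _ _ (mklin fL) (mklin (pair_linear r t))).
  move=> [x k]; rewrite /= /mklin_fun /=; congr pair.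
    by rewrite linearD /= sK ker_inclK addr0.
  apply: val_inj; have /= -> := tE (s x + ker_incl r k).
  by rewrite linearD /= sK ker_inclK addr0 addrC addKr.
by move=> x; rewrite /= /mklin_fun /=; have /= -> := tE x; rewrite addrC subrK.
Qed.

Section Span.
Variable F : fieldType.

(** Coefficients are peeled off one at a time; the length of a spanning sequence stands in for the
    dimension. *)
Fixpoint in_span (V : lmodType F) (s : seq V) (y : V) : Prop :=
  if s is w :: s' then exists c : F, in_span s' (y - c *: w) else y = 0.

Implicit Types V W : lmodType F.

Lemma in_span0 V (s : seq V) : in_span s 0.
Proof. by elim: s => //= w s IH; exists 0; rewrite scale0r subr0. Qed.

Lemma in_spanP V (s : seq V) a x y :
  in_span s x -> in_span s y -> in_span s (a *: x + y).
Proof.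
elim: s x y => [|w s IH] x y /=; first by move=> -> ->; rewrite scaler0 addr0.
move=> [c cx] [c' cy]; exists (a * c + c').
have := IH _ _ cx cy.
by rewrite scalerBr scalerDl scalerA opprD addrACA.
Qed.

Lemma in_span_mem V (s : seq V) x : x \in s -> in_span s x.
Proof.
elim: s => //= w s IH; rewrite inE => /predU1P[->|/IH xs].
  by exists 1; rewrite scale1r subrr; exact: in_span0.
by exists 0; rewrite scale0r subr0.
Qed.

Lemma in_span_sum V (s : seq V) (I : Type) (r : seq I) (f : I -> V) :
  (forall i, in_span s (f i)) -> in_span s (\sum_(i <- r) f i).
Proof.
move=> fs; elim: r => [|i r IH]; first by rewrite big_nil; exact: in_span0.
by rewrite big_cons -[f i]scale1r; exact: in_spanP.
Qed.

Lemma in_span_map V W (g : {linear V -> W}) (s : seq V) y :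
  in_span s y -> in_span (map g s) (g y).
Proof.
elim: s y => [|w s IH] y /=; first by move->; rewrite linear0.
by move=> [c /IH cs]; exists c; rewrite -linearZ -linearB.
Qed.

Lemma span_quotient V W (g : {linear V -> W}) (s : seq V) v :
  in_span s v -> v != 0 -> g v = 0 ->
  exists2 s' : seq W, (size s' < size s)%N &
    forall y, in_span s y -> in_span s' (g y).
Proof.
elim: s v => [|w s IH] v /=; first by move=> ->; rewrite eqxx.
move=> [c vs] v_neq0 gv.
have [c0|c_neq0] := eqVneq c 0.
  move: vs; rewrite c0 scale0r subr0 => vs.
  have [s' ss' s'P] := IH v vs v_neq0 gv.
  exists (g w :: s') => //= y [b yb]; exists b.
  by rewrite -linearZ -linearB; exact: s'P.
exists (map g s) => [|y [b /(in_span_map g) yb]]; first by rewrite size_map.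
have gw : in_span (map g s) (g w).
  have /(in_spanP (- c^-1))/(_ (in_span0 _)) := in_span_map g vs.
  rewrite linearB gv linearZ sub0r addr0 scalerN scaleNr opprK scalerA.
  by rewrite mulVf // scale1r.
by have := in_spanP b gw yb; rewrite linearB linearZ /= addrC subrK.
Qed.

(* Enlarge [V] to [V * F] so that the image of [a] meets each spanning vector *)
(* of [W] in turn; once [a] is surjective, [phi] descends to [W].            *)
Lemma functional_extension V W (a : {linear V -> W}) (phi : {linear V -> F^o})
    (s : seq W) :
  (forall y, in_span s y) -> (forall x, a x = 0 -> phi x = 0) ->
  exists psi : {linear W -> F^o}, forall x, phi x = psi (a x).
Proof.
move=> sP.
have {sP} : forall y, exists x, in_span s (y - a x).
  by move=> y; exists 0; rewrite linear0 subr0.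
elim: s V a phi => [|w s IH] V a phi /= aP aphi.
  apply: lin_factor aphi => y; have [x /eqP] := aP y.
  by rewrite subr_eq0 => /eqP->; exists x.
have [[x0 wE]|w_out] := classic (exists x0, a x0 = w).
  apply: IH aphi => y; have [x [c cs]] := aP y.
  by exists (x + c *: x0); rewrite linearD linearZ /= wE opprD addrA.
have a'L : linear (fun v : V * F^o => a v.1 + (v.2 : F) *: w).
  move=> c [x1 c1] [x2 c2] /=; rewrite linearP scalerDr scalerDl scalerA.
  by rewrite addrACA.
have phi'L : linear (fun v : V * F^o => phi v.1).
  by move=> c [x1 c1] [x2 c2] /=; rewrite linearP.
have [|[x c]|psi psiE] := IH _ (mklin a'L) (mklin phi'L).
- move=> y; have [x [c cs]] := aP y; exists (x, c).
  by rewrite /= /mklin_fun /= opprD addrA.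
- rewrite /= /mklin_fun /=.
  have [->|c_neq0] := eqVneq (c : F) 0.
    by rewrite scale0r addr0; exact: aphi.
  move=> /(canRL (addrK _)); rewrite sub0r => ax; case: w_out.
  exists (- (c : F)^-1 *: x); rewrite linearZ /= ax scalerN scaleNr opprK.
  by rewrite scalerA mulVf // scale1r.
exists psi => x; have := psiE (x, 0).
by rewrite /= /mklin_fun /= scale0r addr0.
Qed.

End Span.

(** * Projective resolutions and Ext *)

Section Homological.
Variable R : pzRingType.
Implicit Types K L M N P Q X : rmodType R.

(* Lift the identity of [P] along the projection from the pullback of [f] and *)
(* [g].                                                                       *)
Lemma proj_lift P M N (g : {linear M -> N}) (f : {linear P -> N}) :
  projective P -> (forall x, exists y, g y = f x) ->
  exists h : {linear P -> M}, forall x, g (h x) = f x.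
Proof.
move=> projP gf.
have dL : linear (fun v : P * M => f v.1 - g v.2).
  move=> a [x y] [x' y'] /=; rewrite !linearP scalerDr.
  by rewrite addrACA.
pose pull := ker_mod (mklin dL).
have [|h hE] := projP _ _ (lfst P M \o ker_incl (mklin dL)) idfun.
  move=> x; have [y gy] := gf x.
  have xy : ker_pred (mklin dL) (x, y).
    by rewrite /ker_pred /= /mklin_fun /= gy subrr.
  by exists (KerMod xy).
exists (lsnd P M \o ker_incl (mklin dL) \o h) => x.
have := ker_inclK (h x); have /= := hE x.
rewrite /= /mklin_fun /= => <- /eqP; rewrite subr_eq0 => /eqP->.
by [].
Qed.

Section Cycles.
Variables (M : rmodType R) (P : proj_resolution M).

(** The augmentation serves as differential out of degree 0, which merges the two exactness fields
    of a resolution. *)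
Definition is_cycle (j : nat) : res_obj P j -> Prop :=
  match j with
  | 0 => fun x => res_aug P x = 0
  | i.+1 => fun x => res_diff P i x = 0
  end.

Lemma is_cycleP j (x : res_obj P j) :
  is_cycle x <-> exists z, res_diff P j z = x.
Proof. by case: j x => [|j] x; [exact: res_exact0 | exact: res_exact]. Qed.

Lemma boundary_cycle j z : is_cycle (res_diff P j z).
Proof. by apply/is_cycleP; exists z. Qed.

Lemma diff_diff j z : res_diff P j (res_diff P j.+1 z) = 0.
Proof. exact: (@boundary_cycle j.+1 z). Qed.

End Cycles.

Section Comparison.
Variables (M : rmodType R) (P Q : proj_resolution M).

Lemma res_compare_step j (h : {linear res_obj P j -> res_obj Q j}) :
  (forall x, is_cycle x -> is_cycle (h x)) ->
  exists h' : {linear res_obj P j.+1 -> res_obj Q j.+1},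
    forall x, res_diff Q j (h' x) = h (res_diff P j x).
Proof.
move=> hc.
have [|h' h'E] := @proj_lift _ _ _ (res_diff Q j) (h \o res_diff P j)
  (@res_proj _ _ P j.+1).
  by move=> x; apply/is_cycleP/hc/boundary_cycle.
by exists h'.
Qed.

End Comparison.

(** The comparison theorem, one degree at a time. The homotopy relation is asked on cycles only,
    where the term from the degree below disappears. *)
Lemma res_compare M (P Q : proj_resolution M) j :
  exists (h : {linear res_obj P j -> res_obj Q j})
         (g : {linear res_obj Q j -> res_obj P j})
         (s : {linear res_obj P j -> res_obj P j.+1}),
    [/\ forall x, is_cycle x -> is_cycle (h x),
        forall y, is_cycle y -> is_cycle (g y)
      & forall x, is_cycle x -> res_diff P j (s x) = x - g (h x)].
Proof.
elim: j => [|j [h [g [s [hc gc sE]]]]].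
  have lift0 (P1 P2 : proj_resolution M) :
      exists h : {linear res_obj P1 0 -> res_obj P2 0},
        forall x, res_aug P2 (h x) = res_aug P1 x.
    by apply: proj_lift; [exact: res_proj | move=> x; exact: res_surj].
  have [h hE] := lift0 P Q; have [g gE] := lift0 Q P.
  have [|s sE] := @proj_lift _ _ _ (res_diff P 0)
    (idfun \- (g \o h)) (@res_proj _ _ P 0).
    by move=> x; apply/res_exact0; rewrite /= linearB /= gE hE subrr.
  exists h, g, s; split=> [x|y|x _] /=; rewrite ?hE ?gE //.
have [h' h'E] := res_compare_step hc.
have [g' g'E] := res_compare_step gc.
(* The map to lift takes values in cycles: its boundary vanishes by the relation for [s], applied to
   the cycle [res_diff P j x]. *)
have [|s' s'E] := @proj_lift _ _ _ (res_diff P j.+1)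
    ((idfun \- (g' \o h')) \- (s \o res_diff P j)) (@res_proj _ _ P j.+1).
  move=> x; apply/res_exact; rewrite /= !linearB /= g'E h'E.
  by rewrite sE ?subrr //; exact: boundary_cycle.
exists h', g', s'; split=> [x /= xc|y /= yc|x /= xc].
- by rewrite h'E xc linear0.
- by rewrite g'E yc linear0.
by rewrite s'E /= xc linear0 subr0.
Qed.

Definition vanishes_on (i : nat) M N (P : proj_resolution M) : Prop :=
  forall f : {linear res_obj P i.+1 -> N},
    (forall x, f (res_diff P i.+1 x) = 0) ->
    exists g : {linear res_obj P i -> N}, f =1 g \o res_diff P i.

(** The cocycle [f] is pulled back to [Q] and is a coboundary there; returning to [P] costs the
    homotopy term [f \o s]. *)
Lemma vanishes_transfer i M N (P Q : proj_resolution M) :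
  vanishes_on i N Q -> vanishes_on i N P.
Proof.
move=> vQ f fd.
have f_eq x x' : res_diff P i x = res_diff P i x' -> f x = f x'.
  move=> e; apply/eqP; rewrite -subr_eq0 -linearB.
  have /(@res_exact _ _ P i)[z <-] : res_diff P i (x - x') = 0.
    by rewrite linearB e subrr.
  by rewrite fd.
have [h [g [s [hc gc sE]]]] := res_compare P Q i.
have [g' g'E] := res_compare_step gc.
have [|e eE] := vQ (f \o g').
  move=> z /=; rewrite -(linear0 f); apply: f_eq.
  by rewrite g'E diff_diff !linear0.
exists ((e \o h) \+ (f \o s)) => x /=.
have /is_cycleP[z zE] := hc _ (boundary_cycle x).
rewrite -zE; have /= <- := eE z; rewrite -linearD /=; apply: f_eq.
rewrite linearD g'E zE sE; last exact: boundary_cycle.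
by rewrite addrC subrK.
Qed.

Lemma Ext_vanishesP i M N (P : proj_resolution M) :
  Ext_vanishes i.+1 M N <-> vanishes_on i N P.
Proof.
by split=> [v|v Q]; [exact: (v P) | exact: vanishes_transfer v].
Qed.

Definition zero_mod : rmodType R := 'rV[R^c]_0.

Lemma zero_modP (x y : zero_mod) : x = y.
Proof. by apply/rowP => -[]. Qed.

Lemma projective_zero : projective zero_mod.
Proof.
move=> M N g f _; exists \0 => x.
by rewrite /= (zero_modP x 0) !linear0.
Qed.

Section TrivialResolution.
Variables (M : rmodType R) (projM : projective M).

Definition triv_obj (i : nat) : rmodType R := if i is 0 then M else zero_mod.
Definition triv_diff i : {linear triv_obj i.+1 -> triv_obj i} := \0.

Definition triv_resolution : proj_resolution M.
Proof.
refine (@ProjResolution R M triv_obj triv_diff idfun _ _ _ _).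
- by case=> [|i]; [exact: projM | exact: projective_zero].
- by move=> x; exists x.
- by move=> x; split=> [/= -> | [z <-] //]; exists 0.
by move=> i y; split=> // _; exists 0; exact: zero_modP.
Defined.

End TrivialResolution.

Lemma projective_Ext i M N : projective M -> Ext_vanishes i.+1 M N.
Proof.
move=> projM; apply/(Ext_vanishesP _ _ (triv_resolution projM)) => f _.
by exists \0 => x /=; rewrite (zero_modP x 0) !linear0.
Qed.

Section Splice.
Variables (K Q M : rmodType R) (u : {linear K -> Q}) (q : {linear Q -> M}).
Hypothesis projQ : projective Q.
Hypothesis u_inj : forall x, u x = 0 -> x = 0.
Hypothesis uq_exact : forall y, q y = 0 <-> exists x, u x = y.
Hypothesis q_surj : forall y, exists x, q x = y.
Variable PK : proj_resolution K.

Definition splice_obj (i : nat) : rmodType R :=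
  if i is j.+1 then res_obj PK j else Q.

Definition splice_diff i : {linear splice_obj i.+1 -> splice_obj i} :=
  match i with
  | 0 => u \o res_aug PK
  | j.+1 => res_diff PK j
  end.

(** Kept transparent: [Ext_shift] holds because degree [i.+1] here computes to degree [i] of
    [PK]. *)
Definition splice_resolution : proj_resolution M.
Proof.
refine (@ProjResolution R M splice_obj splice_diff q _ _ _ _).
- by case=> [|i]; [exact: projQ | exact: res_proj].
- exact: q_surj.
- move=> y; split=> [/uq_exact[x <-]|[z <-]].
    by have [z <-] := res_surj PK x; exists z.
  by apply/uq_exact; exists (res_aug PK z).
case=> [|i] y; last exact: res_exact.
split=> [/u_inj/res_exact0|[z <-]] //=.
by rewrite (_ : res_aug _ _ = 0) ?linear0 //; apply/res_exact0; exists z.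
Defined.

Lemma Ext_shift i N : Ext_vanishes i.+2 M N <-> Ext_vanishes i.+1 K N.
Proof.
by rewrite (Ext_vanishesP _ _ splice_resolution) (Ext_vanishesP _ _ PK).
Qed.

(** A cocycle in degree 1 is a map on [res_obj PK 0] that kills boundaries, hence a map on [K]; it
    is a coboundary when that map extends along [u]. *)
Lemma Ext1_extension N :
  Ext_vanishes 1 M N <->
  forall f : {linear K -> N}, exists g : {linear Q -> N}, forall x, f x = g (u x).
Proof.
rewrite (Ext_vanishesP _ _ splice_resolution); split=> v f.
  have [|g gE] := v (f \o res_aug PK).
    by move=> x /=; rewrite (_ : res_aug _ _ = 0) ?linear0 //;
      apply/res_exact0; exists x.
  by exists g => x; have [z <-] := res_surj PK x; exact: gE.
move=> fd; have [||g gE] := @lin_factor _ _ _ _ (res_aug PK) f.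
- exact: res_surj.
- by move=> x /res_exact0[z <-]; exact: fd.
have [h hE] := v g; exists h => x /=.
by rewrite gE hE.
Qed.

End Splice.

Lemma Ext_retract i N M X (s : {linear X -> M}) (r : {linear M -> X}) :
  cancel s r -> Ext_vanishes i.+1 N M -> Ext_vanishes i.+1 N X.
Proof.
move=> sK v P f fd; have [|g gE] := v P (s \o f).
  by move=> x /=; rewrite fd linear0.
by exists (r \o g) => x /=; have /= <- := gE x; rewrite sK.
Qed.

Lemma fg_image M N (g : {linear M -> N}) :
  (forall y, exists x, g x = y) -> finitely_generated M -> finitely_generated N.
Proof.
move=> g_surj [m [v vP]]; exists m, (g \o v) => y.
have [x <-] := g_surj y; have [c ->] := vP x; exists c.
by rewrite linear_sum; apply: eq_bigr => i _; rewrite linearZ.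
Qed.

End Homological.

(** * Modules over Lambda *)

Lemma hi_inj n : injective (@hi n).
Proof. by move=> k l /(congr1 val) /= /succn_inj /val_inj. Qed.

Lemma lo_inj n : injective (@lo n).
Proof. by move=> k l /(congr1 val) /= /val_inj. Qed.

Section LambdaElements.
Variables (F : fieldType) (n : nat).
Local Notation L := (Lambda F n).
Local Notation Lc := (L : pzRingType)^c.

Definition elt (v : 'I_n -> F) (w : 'I_n.-1 -> F) : rad2 F (linear_quiver n) :=
  [ffun p => match p with inl i => v i | inr k => w k end].

Definition cv (c : Lc) (i : 'I_n) : F := (c : rad2 F (linear_quiver n)) (inl i).
Definition ca (c : Lc) (k : 'I_n.-1) : F :=
  (c : rad2 F (linear_quiver n)) (inr k).

Definition scal (r : F) : Lc := elt (fun=> r) (fun=> 0).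
Definition ev (i : 'I_n) : Lc := elt (fun j => (j == i)%:R) (fun=> 0).
Definition ea (k : 'I_n.-1) : Lc := elt (fun=> 0) (fun l => (l == k)%:R).
(* The arrow into, resp. out of, the vertex [i], and [0] if there is none. *)
Definition ain (i : 'I_n) : Lc := elt (fun=> 0) (fun l => (lo l == i)%:R).
Definition aout (i : 'I_n) : Lc := elt (fun=> 0) (fun l => (hi l == i)%:R).

Lemma LcP (a b : Lc) : cv a =1 cv b -> ca a =1 ca b -> a = b.
Proof. by move=> ab ab'; apply/ffunP => -[i|k]; [exact: ab | exact: ab']. Qed.

(** The product is that of the converse ring, so the factors are swapped with respect to
    [rad2_mul]. *)
Lemma cvM a b i : cv (a * b) i = cv b i * cv a i.
Proof. by rewrite /cv ffunE. Qed.
Lemma caM a b k : ca (a * b) k = cv b (hi k) * ca a k + ca b k * cv a (lo k).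
Proof. by rewrite /ca ffunE. Qed.
Lemma cvD a b i : cv (a + b) i = cv a i + cv b i.
Proof. by rewrite /cv ffunE. Qed.
Lemma caD a b k : ca (a + b) k = ca a k + ca b k.
Proof. by rewrite /ca ffunE. Qed.
Lemma cv0 i : cv 0 i = 0. Proof. by rewrite /cv ffunE. Qed.
Lemma ca0 k : ca 0 k = 0. Proof. by rewrite /ca ffunE. Qed.
Lemma cv1 i : cv 1 i = 1. Proof. by rewrite /cv ffunE. Qed.
Lemma ca1 k : ca 1 k = 0. Proof. by rewrite /ca ffunE. Qed.
Lemma cv_elt v w i : cv (elt v w) i = v i. Proof. by rewrite /cv ffunE. Qed.
Lemma ca_elt v w k : ca (elt v w) k = w k. Proof. by rewrite /ca ffunE. Qed.

Definition lcoefE := (cvM, caM, cvD, caD, cv0, ca0, cv1, ca1, cv_elt, ca_elt).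
Definition unitalE := (@mul0r F, @mulr0 F, @mul1r F, @mulr1 F, @add0r F, @addr0 F).

Lemma scal_comm r c : scal r * c = c * scal r.
Proof.
by apply: LcP => j; rewrite !lcoefE ?unitalE // mulrC.
Qed.

Lemma scalM r s : scal r * scal s = scal (r * s).
Proof. by apply: LcP => j; rewrite !lcoefE ?unitalE // mulrC. Qed.

Lemma scalD r s : scal (r + s) = scal r + scal s.
Proof. by apply: LcP => j; rewrite !lcoefE ?unitalE. Qed.

Lemma scal1 : scal 1 = 1.
Proof. by apply: LcP => j; rewrite !lcoefE. Qed.

Lemma scal0 : scal 0 = 0.
Proof. by apply: LcP => j; rewrite !lcoefE. Qed.

Lemma ain_lo k : ain (lo k) = ea k.
Proof. by apply: LcP => l; rewrite !lcoefE ?(inj_eq (@lo_inj n)). Qed.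

Lemma aout_hi k : aout (hi k) = ea k.
Proof. by apply: LcP => l; rewrite !lcoefE ?(inj_eq (@hi_inj n)). Qed.

Lemma aout0 (i : 'I_n) : i = 0%N :> nat -> aout i = 0.
Proof.
move=> i0; apply: LcP => l; rewrite !lcoefE //.
by case: eqP => // /(congr1 val) /=; rewrite i0.
Qed.

Lemma ea_mul k c : ea k * c = scal (cv c (hi k)) * ea k.
Proof.
apply: LcP => l; rewrite !lcoefE ?unitalE //; case: eqP => [->|_]; rewrite ?unitalE //.
Qed.

Lemma mul_ea k c : c * ea k = scal (cv c (lo k)) * ea k.
Proof.
apply: LcP => l; rewrite !lcoefE ?unitalE //; case: eqP => [->|_]; rewrite ?unitalE //.
Qed.

Lemma ev_mul i c :
  ev i * c = scal (cv c i) * ev i + scal (\sum_(k | lo k == i) ca c k) * ain i.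
Proof.
apply: LcP => l; rewrite !lcoefE ?unitalE //.
  by case: eqP => [->|_]; rewrite ?unitalE.
case: eqP => [<-|_]; rewrite ?unitalE //.
rewrite (big_pred1 l) // => k; exact: (inj_eq (@lo_inj n)).
Qed.

Lemma mul_ev i c :
  c * ev i = scal (cv c i) * ev i + scal (\sum_(k | hi k == i) ca c k) * aout i.
Proof.
apply: LcP => l; rewrite !lcoefE ?unitalE //.
  by case: eqP => [->|_]; rewrite ?unitalE.
case: eqP => [<-|_]; rewrite ?unitalE //.
rewrite (big_pred1 l) // => k; exact: (inj_eq (@hi_inj n)).
Qed.

Lemma ev_mul_lo k c :
  ev (lo k) * c = scal (cv c (lo k)) * ev (lo k) + scal (ca c k) * ea k.
Proof.
rewrite ev_mul ain_lo (big_pred1 k) // => l; exact: (inj_eq (@lo_inj n)).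
Qed.

Lemma evM i j : ev i * ev j = if i == j then ev i else 0.
Proof.
have [->|ij] := eqVneq i j; apply: LcP => l; rewrite !lcoefE ?unitalE //.
  by case: eqP; rewrite ?unitalE.
have [->|_] := eqVneq l j; last by rewrite ?unitalE.
by rewrite eq_sym (negPf ij) ?unitalE.
Qed.

Lemma cv_sum (I : Type) (r : seq I) (f : I -> Lc) l :
  cv (\sum_(i <- r) f i) l = \sum_(i <- r) cv (f i) l.
Proof. by apply: (big_morph (@cv^~ l)) => [a b|]; rewrite lcoefE. Qed.

Lemma ca_sum (I : Type) (r : seq I) (f : I -> Lc) l :
  ca (\sum_(i <- r) f i) l = \sum_(i <- r) ca (f i) l.
Proof. by apply: (big_morph (@ca^~ l)) => [a b|]; rewrite lcoefE. Qed.

Lemma sum_ev : \sum_i ev i = 1.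
Proof.
apply: LcP => l; rewrite ?cv_sum ?ca_sum !lcoefE; last first.
  by rewrite big1 // => i _; rewrite lcoefE.
rewrite (bigD1 l) //= lcoefE eqxx big1 ?addr0 // => i /negPf il.
by rewrite lcoefE eq_sym il.
Qed.

Lemma elt_sum (c : Lc) :
  c = \sum_i scal (cv c i) * ev i + \sum_k scal (ca c k) * ea k.
Proof.
apply: LcP => l; rewrite lcoefE ?cv_sum ?ca_sum.
  rewrite (bigD1 l) //= !big1 => [|k _|i /negPf il]; rewrite !lcoefE ?unitalE //.
  - by rewrite eqxx ?unitalE.
  - by rewrite eq_sym il ?unitalE.
rewrite big1 => [|i _]; last by rewrite !lcoefE ?unitalE.
rewrite (bigD1 l) //= !big1 => [|k /negPf kl]; rewrite !lcoefE ?unitalE //.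
  by rewrite eqxx ?unitalE.
by rewrite eq_sym kl ?unitalE.
Qed.

End LambdaElements.

Section Regular.
Variable R : pzRingType.

Definition reg_mod : rmodType R := (R^c)^o.

Lemma reg_map_linear (M : rmodType R) (x : M) :
  linear ((fun c => (c : R^c) *: x) : reg_mod -> M).
Proof. by move=> a c c'; rewrite scalerDl -scalerA. Qed.

Definition reg_map (M : rmodType R) (x : M) : {linear reg_mod -> M} :=
  mklin (reg_map_linear x).

Lemma reg_hom (M : rmodType R) (f : {linear reg_mod -> M}) (c : R^c) :
  f c = c *: f (1 : R^c).
Proof. by rewrite -linearZ; congr (f _); rewrite /GRing.scale /= mulr1. Qed.

Lemma projective_reg : projective reg_mod.
Proof.
move=> M N g f g_surj; have [x gx] := g_surj (f (1 : R^c)).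
by exists (reg_map x) => c; rewrite reg_hom -gx -linearZ.
Qed.

Lemma fg_cyclic (M : rmodType R) (x : M) :
  (forall y, exists c : R^c, y = c *: x) -> finitely_generated M.
Proof.
move=> xP; exists 1%N, (fun=> x) => y; have [c ->] := xP y.
by exists (fun=> c); rewrite big_ord1.
Qed.

Lemma fg_reg : finitely_generated reg_mod.
Proof.
apply: (@fg_cyclic reg_mod (1 : R^c)) => c.
by exists c; rewrite /GRing.scale /= mulr1.
Qed.

End Regular.

Section LambdaModules.
Variables (F : fieldType) (n : nat).
Local Notation L := (Lambda F n).
Local Notation Lc := (L : pzRingType)^c.
Local Notation scal := (@scal F n).
Local Notation ev := (@ev F n).
Local Notation ea := (@ea F n).
Local Notation ain := (@ain F n).
Local Notation aout := (@aout F n).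
Implicit Types M N : rmodType L.

Section Action.
Variable M : rmodType L.
Implicit Types x y : M.

Lemma ea_ea k l x : ea k *: (ea l *: x) = 0.
Proof. by rewrite scalerA ea_mul cv_elt scal0 mul0r scale0r. Qed.

Lemma ev_ev i x : ev i *: (ev i *: x) = ev i *: x.
Proof. by rewrite scalerA evM eqxx. Qed.

Lemma ev_evN i j x : i != j -> ev i *: (ev j *: x) = 0.
Proof. by move=> /negPf ij; rewrite scalerA evM ij scale0r. Qed.

Lemma ev_ea k x : ev (lo k) *: (ea k *: x) = ea k *: x.
Proof. by rewrite scalerA mul_ea cv_elt eqxx scal1 mul1r. Qed.

Lemma ea_ev k x : ea k *: (ev (hi k) *: x) = ea k *: x.
Proof. by rewrite scalerA ea_mul cv_elt eqxx scal1 mul1r. Qed.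

Lemma scal_scale r (c : Lc) x : scal r *: (c *: x) = c *: (scal r *: x).
Proof. by rewrite !scalerA scal_comm. Qed.

Lemma sum_evE x : x = \sum_i ev i *: x.
Proof. by rewrite -scaler_suml sum_ev scale1r. Qed.

Lemma ev_eq0 x : (forall i, ev i *: x = 0) -> x = 0.
Proof. by move=> x0; rewrite (sum_evE x) big1. Qed.

End Action.

Definition Flin M (phi : M -> F) : Prop :=
  forall r x y, phi (scal r *: x + y) = r * phi x + phi y.

Section Flin.
Variables (M : rmodType L) (phi : M -> F) (phiL : Flin phi).
Lemma Flin0 : phi 0 = 0.
Proof.
have := phiL 1 0 0; rewrite scaler0 addr0 mul1r => /eqP.
by rewrite -subr_eq0 opprD addNKr oppr_eq0 => /eqP.
Qed.
End Flin.

Lemma SactE i (c : Lc) (v : Smod F i) : c *: v = (v : F) * cv c i.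
Proof. by []. Qed.

Lemma IactE k (c : Lc) (v : Imod F k) :
  c *: v = (v.1 * cv c (hi k), v.1 * ca c k + v.2 * cv c (lo k)) :> F * F.
Proof. by []. Qed.

Lemma hi_lo_neq (k : 'I_n.-1) : hi k != lo k.
Proof. by rewrite -val_eqE /= gtn_eqF. Qed.

Section MapsFromI.
Variables (k : 'I_n.-1) (M : rmodType L).

Definition gen_coef (v : Imod F k) : Lc :=
  scal v.1 * ev (hi k) + scal v.2 * ea k.

Lemma gen_coefP (v : Imod F k) : v = gen_coef v *: ((1, 0) : Imod F k).
Proof.
case: v => a b; rewrite IactE /gen_coef !lcoefE !eqxx /=.
by rewrite ?unitalE.
Qed.

Lemma fromI_linear (x : M) :
  linear ((fun v => gen_coef v *: x) : Imod F k -> M).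
Proof.
move=> a u v /=; rewrite scalerA -scalerDl; congr (_ *: x).
apply: LcP => l; rewrite /gen_coef !lcoefE /=.
  have [->|_] := eqVneq l (hi k); rewrite ?unitalE //.
have [->|/negPf lk] := eqVneq l k; rewrite ?unitalE // ?eqxx ?mul1r //.
by rewrite (inj_eq (@hi_inj n)) lk ?unitalE.
Qed.

(** [Imod F k] is the indecomposable projective with top at [hi k]: maps out of it are elements at
    [hi k], and only that component of [x] matters. *)
Definition fromI (x : M) : {linear Imod F k -> M} := mklin (fromI_linear x).

Lemma fromIE x v : fromI x v = gen_coef v *: x.
Proof. by []. Qed.

Lemma fromI_gen x : fromI x (1, 0) = ev (hi k) *: x.
Proof. by rewrite fromIE /gen_coef /= scal1 scal0 mul1r mul0r addr0. Qed.

Lemma fromI_soc x : fromI x (0, 1) = ea k *: x.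
Proof. by rewrite fromIE /gen_coef /= scal1 scal0 mul1r mul0r add0r. Qed.

Lemma homI (f : {linear Imod F k -> M}) v : f v = fromI (f (1, 0)) v.
Proof. by rewrite fromIE -linearZ -gen_coefP. Qed.

Lemma homI_eq (f g : {linear Imod F k -> M}) :
  f (1, 0) = g (1, 0) -> forall v, f v = g v.
Proof. by move=> e v; rewrite homI e -homI. Qed.

Lemma homI_gen (f : {linear Imod F k -> M}) :
  f (1, 0) = ev (hi k) *: f (1, 0).
Proof. by rewrite {1}homI fromI_gen. Qed.

Lemma homI_soc (f : {linear Imod F k -> M}) : f (0, 1) = ea k *: f (1, 0).
Proof. by rewrite homI fromI_soc. Qed.

End MapsFromI.

Section MapsFromS.
Variables (i : 'I_n) (M : rmodType L).

Section Def.
Variables (x : M) (xi : ev i *: x = x) (xo : aout i *: x = 0).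

Lemma scal_socle (c : Lc) : c *: x = scal (cv c i) *: x.
Proof.
by rewrite -{1}xi scalerA mul_ev scalerDl -!scalerA xo scaler0 addr0 xi.
Qed.

Lemma fromS_linear : linear ((fun v => scal (v : F) *: x) : Smod F i -> M).
Proof.
move=> a u v; rewrite /= -scal_scale (scal_socle a) scalerA scalM.
by rewrite SactE scalD scalerDl.
Qed.

Definition fromS : {linear Smod F i -> M} := mklin fromS_linear.

Lemma fromSE v : fromS v = scal (v : F) *: x.
Proof. by []. Qed.

Lemma fromS1 : fromS (1 : F) = x.
Proof. by rewrite fromSE scal1 scale1r. Qed.

End Def.

Lemma S_gen (v : Smod F i) : v = scal (v : F) *: ((1 : F) : Smod F i).
Proof. by rewrite SactE lcoefE mul1r. Qed.

Lemma homS (f : {linear Smod F i -> M}) v : f v = scal (v : F) *: f (1 : F).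
Proof. by rewrite -linearZ -S_gen. Qed.

Lemma homS_eq (f g : {linear Smod F i -> M}) :
  f (1 : F) = g (1 : F) -> forall v, f v = g v.
Proof. by move=> e v; rewrite homS e -homS. Qed.

Lemma homS_ev (f : {linear Smod F i -> M}) : ev i *: f (1 : F) = f (1 : F).
Proof. by rewrite -linearZ; congr (f _); rewrite SactE lcoefE eqxx mulr1. Qed.

Lemma homS_aout (f : {linear Smod F i -> M}) : aout i *: f (1 : F) = 0.
Proof. by rewrite -linearZ SactE lcoefE mulr0 linear0. Qed.

End MapsFromS.

Section MapsTo.
Variables (M : rmodType L) (phi : M -> F) (phiL : Flin phi).

(** Injectivity of [Imod F k] in concrete form: a functional on the space at [lo k] is a map into
    it, the top coordinate being forced by the arrow. *)
Lemma toI_linear k :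
  linear ((fun y => (phi (ea k *: y), phi (ev (lo k) *: y))) : M -> Imod F k).
Proof.
move=> c x y; rewrite IactE /= !scalerDr !scalerA ea_mul ev_mul_lo.
rewrite scalerDl -!scalerA -addrA !phiL.
rewrite !(mulrC (cv _ _)) (mulrC (ca _ _)).
by congr pair; rewrite //= addrCA addrA.
Qed.

Definition toI k : {linear M -> Imod F k} := mklin (toI_linear k).

Lemma toS_linear i (phii : forall x, phi (ain i *: x) = 0) :
  linear ((fun y => phi (ev i *: y)) : M -> Smod F i).
Proof.
move=> c x y; rewrite SactE /= !scalerDr !scalerA ev_mul.
rewrite scalerDl -!scalerA -addrA !phiL phii mulr0 add0r.
by rewrite mulrC.
Qed.

Definition toS i phii : {linear M -> Smod F i} := mklin (toS_linear phii).

End MapsTo.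

End LambdaModules.

Section ScalarRestriction.
Variables (F : fieldType) (n : nat) (M : rmodType (Lambda F n)).

(** The module as a vector space over [F] through [scal], so that the lemmas on spans apply. *)
Definition base : Type := M.

HB.instance Definition _ := GRing.Zmodule.copy base M.

Definition base_scale (r : F) (x : base) : base := scal n r *: (x : M).

Fact base_scaleA a b v : base_scale a (base_scale b v) = base_scale (a * b) v.
Proof. by rewrite /base_scale scalerA scalM. Qed.
Fact base_scale1 : left_id 1 base_scale.
Proof. by move=> v; rewrite /base_scale scal1 scale1r. Qed.
Fact base_scaleDr : right_distributive base_scale +%R.
Proof. by move=> a u v; rewrite /base_scale scalerDr. Qed.
Fact base_scaleDl v : {morph base_scale^~ v : a b / a + b}.
Proof. by move=> a b; rewrite /base_scale scalD scalerDl. Qed.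

HB.instance Definition _ := GRing.Zmodule_isLmodule.Build F base
  base_scaleA base_scale1 base_scaleDr base_scaleDl.

Lemma base_act_linear (c : (Lambda F n : pzRingType)^c) :
  linear ((fun x : M => c *: x) : base -> base).
Proof. by move=> r x y; rewrite scalerDr; congr (_ + _); exact/esym/scal_scale. Qed.

Lemma fg_span : finitely_generated M -> exists s : seq base, forall y, in_span s y.
Proof.
case=> m [g gP].
pose s : seq base := [seq ev F i *: g a | a <- enum 'I_m, i <- enum 'I_n] ++
  [seq ea F k *: g a | a <- enum 'I_m, k <- enum 'I_n.-1].
exists s => y; have [c ->] := gP y.
have scale_span r (x : base) : in_span s x -> in_span s (r *: x).
  by move=> xs; have := in_spanP r xs (in_span0 s); rewrite addr0.
apply: (@in_span_sum F base) => a; rewrite [c a]elt_sum scalerDl !scaler_suml.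
have spanD (u v : base) : in_span s u -> in_span s v -> in_span s (u + v).
  by move=> us vs; rewrite -[u]scale1r; exact: in_spanP.
apply: spanD; apply: (@in_span_sum F base) => i; rewrite -scalerA;
    apply: scale_span; apply: in_span_mem; rewrite mem_cat; apply/orP.
  by left; apply/allpairsP; exists (a, i); rewrite !mem_enum.
by right; apply/allpairsP; exists (a, i); rewrite !mem_enum.
Qed.

End ScalarRestriction.

Section Functionals.
Variables (F : fieldType) (n : nat).
Local Notation L := (Lambda F n).
Local Notation Lc := (L : pzRingType)^c.
Local Notation scal := (@scal F n).
Local Notation ev := (@ev F n).
Local Notation ea := (@ea F n).
Local Notation ain := (@ain F n).
Local Notation aout := (@aout F n).
Implicit Types M N X : rmodType L.

Lemma functional_factor M (c : Lc) (phi : M -> F) :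
  finitely_generated M -> Flin phi -> (forall x, c *: x = 0 -> phi x = 0) ->
  exists2 psi : M -> F, Flin psi & forall x, phi x = psi (c *: x).
Proof.
move=> /fg_span[s sP] phiL phic.
have [|psi psiE] := functional_extension (a := mklin (base_act_linear (M:=M) c))
  (phi := mklin (phiL : linear (phi : base M -> F^o))) sP; first exact: phic.
by exists psi => // r x y; exact: (linearP psi r x y).
Qed.

Lemma functional_separate M (c : Lc) (x : M) :
  finitely_generated M -> ~ (exists y, x = c *: y) ->
  exists psi : M -> F, [/\ Flin psi, psi x = 1 & forall y, psi (c *: y) = 0].
Proof.
move=> /fg_span[s sP] x_out.
(* The second coordinate is extended along [(y, r) |-> c y + r x]; a zero of this map with [r]
   nonzero would put [x] in the image of [c]. *)
have aL : linear ((fun v => (c *: (v.1 : M) : base M) + (v.2 : F) *: (x : base M))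
    : base M * F^o -> base M).
  move=> r [y a] [z b]; rewrite /= scalerDr scalerDl scalerDr addrACA.
  congr (_ + _); congr (_ + _); [exact/esym/scal_scale | exact/esym/scalerA].
have [|psi psiE] := functional_extension (a := mklin aL)
  (phi := lsnd (base M) F^o) sP.
  case=> y r; rewrite /= /mklin_fun /= => e.
  have [->//|r_neq0] := eqVneq (r : F) 0; case: x_out.
  exists (- (scal (r : F)^-1 *: y)); rewrite scalerN -scal_scale.
  have -> : c *: y = - (scal r *: x) by apply/eqP; rewrite -addr_eq0; apply/eqP.
  by rewrite scalerN opprK scalerA scalM mulVf // scal1 scale1r.
exists psi; split=> [r y z||y]; first exact: (linearP psi r y z).
  have := psiE (0, 1); rewrite /= /mklin_fun /= scaler0 add0r scale1r.
  by move=> <-.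
have := psiE (y, 0); rewrite /= /mklin_fun /= scale0r addr0.
by move=> <-.
Qed.

End Functionals.

(** * Exactness at a vertex, split summands, and Ext out of simples *)

Section Exactness.
Variables (F : fieldType) (n : nat).
Local Notation L := (Lambda F n).
Local Notation Lc := (L : pzRingType)^c.
Local Notation scal := (@scal F n).
Local Notation ev := (@ev F n).
Local Notation ea := (@ea F n).
Local Notation ain := (@ain F n).
Local Notation aout := (@aout F n).
Implicit Types (M N X : rmodType L) (i j : 'I_n) (k l : 'I_n.-1).

(** Vanishing homology at [i] of the complex formed by the vertex spaces and the arrows; it is a
    complex by [ea_ea]. *)
Definition exact_at (i : 'I_n) M : Prop :=
  forall x : M, ev i *: x = x -> aout i *: x = 0 -> exists y, x = ain i *: y.

Definition retract X M : Prop :=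
  exists (s : {linear X -> M}) (r : {linear M -> X}), cancel s r.

Lemma exact_at_retract i X M : retract X M -> exact_at i M -> exact_at i X.
Proof.
move=> [s [r sK]] Mi x xi xo; have [||y sx] := Mi (s x).
- by rewrite -linearZ xi.
- by rewrite -linearZ xo linear0.
by exists (r y); rewrite -linearZ -sx sK.
Qed.

Lemma exact_at_sum i M N : exact_at i M -> exact_at i N -> exact_at i (M * N)%type.
Proof.
move=> Mi Ni [x y] [xi yi] [xo yo].
have [x' ->] := Mi x xi xo; have [y' ->] := Ni y yi yo.
by exists (x', y').
Qed.

Lemma exact_at_S i j : exact_at i (Smod F j) <-> i != j.
Proof.
split=> [ij|ij x xi _].
  apply/eqP => e; subst j; have [||y /eqP] := ij (1 : F).
  - by rewrite SactE lcoefE eqxx mulr1.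
  - by rewrite SactE lcoefE mulr0.
  by rewrite SactE lcoefE mulr0 oner_eq0.
exists 0; rewrite scaler0 -xi SactE lcoefE eq_sym (negPf ij) mulr0.
by [].
Qed.

Lemma exact_at_I i k : exact_at i (Imod F k).
Proof.
move=> [a b]; rewrite !IactE !lcoefE ?unitalE => -[] /= <- <- -[].
have [->|ki] := eqVneq i (hi k).
  rewrite eq_sym (negPf (hi_lo_neq k)) !mulr1 mulr0 => ->.
  by exists 0; rewrite scaler0.
rewrite mulr0 => _; exists (b, 0); rewrite IactE !lcoefE ?unitalE /=.
by [].
Qed.

(** A cycle that is no boundary maps [Smod F i] in; a functional with value 1 on it and 0 on
    boundaries maps back. *)
Lemma split_S i M :
  finitely_generated M -> ~ exact_at i M -> retract (Smod F i) M.
Proof.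
move=> fgM Mi; have [x xP] := not_all_ex_not _ _ Mi.
have [xi xP'] := imply_to_and _ _ xP; have [xo x_out] := imply_to_and _ _ xP'.
have [phi [phiL phix phi0]] := functional_separate fgM x_out.
exists (fromS xi xo), (toS phiL phi0) => v.
apply: (homS_eq (f := toS phiL phi0 \o fromS xi xo) (g := idfun)).
by rewrite /= fromS1 ?xi // /mklin_fun xi.
Qed.

Lemma split_I k M (x : M) :
  finitely_generated M -> ea k *: x != 0 -> retract (Imod F k) M.
Proof.
move=> fgM x_neq0; have [|phi [phiL phix _]] := @functional_separate _ _ M 0 (ea k *: x) fgM.
  by case=> y; rewrite scale0r => /eqP; rewrite (negPf x_neq0).
exists (fromI k x), (toI phiL k) => v.
apply: (homI_eq (f := toI phiL k \o fromI k x) (g := idfun)).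
rewrite /= fromI_gen /mklin_fun /= ea_ev ev_evN 1?eq_sym ?hi_lo_neq // Flin0 //.
by rewrite phix.
Qed.

Lemma projective_I k : projective (Imod F k).
Proof.
move=> M N g f g_surj; have [x gx] := g_surj (f (1, 0)).
exists (fromI k x) => v /=.
by rewrite [LHS]homI !fromIE linearZ gx.
Qed.

Lemma projective_S (i : 'I_n) : i = 0%N :> nat -> projective (Smod F i).
Proof.
move=> i0 M N g f g_surj; have [x gx] := g_surj (f (1 : F)).
have xo : aout i *: (ev i *: x) = 0 by rewrite aout0 // scale0r.
exists (fromS (ev_ev i x) xo) => v /=.
by rewrite [LHS]homS -(homS_ev f) -gx -!linearZ.
Qed.

Lemma fg_I k : finitely_generated (Imod F k).
Proof.
by apply: (@fg_cyclic L (Imod F k) (1, 0)) => v; exists (gen_coef v); exact: gen_coefP.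
Qed.

Lemma fg_S i : finitely_generated (Smod F i).
Proof.
by apply: (@fg_cyclic L (Smod F i) (1 : F)) => v; exists (scal v); exact: S_gen.
Qed.

(* The short exact sequence [0 -> S(lo k) -> I(k) -> S(hi k) -> 0]. *)
Section SimpleSequence.
Variable k : 'I_n.-1.

(** The index is tied to [lo k] by an equation, so that modules whose indices are computed
    separately can be joined. *)
Lemma soc_I_linear i (e : i = lo k) :
  linear ((fun v => (0, v : F)) : Smod F i -> Imod F k).
Proof.
by move=> c u v; subst i; rewrite IactE SactE; congr pair; rewrite /= !mul0r add0r.
Qed.
Definition soc_I i (e : i = lo k) : {linear Smod F i -> Imod F k} :=
  mklin (soc_I_linear e).

Lemma top_I_linear i (e : hi k = i) :
  linear ((fun v => v.1) : Imod F k -> Smod F i).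
Proof. by move=> c u v; subst i; rewrite IactE SactE. Qed.
Definition top_I i (e : hi k = i) : {linear Imod F k -> Smod F i} :=
  mklin (top_I_linear e).

Lemma step_I_linear l (e : hi k = lo l) :
  linear ((fun v => (0, v.1)) : Imod F k -> Imod F l).
Proof.
by move=> c u v; rewrite !IactE /= -e; congr pair; rewrite /= !mul0r add0r.
Qed.
Definition step_I l (e : hi k = lo l) : {linear Imod F k -> Imod F l} :=
  mklin (step_I_linear e).

End SimpleSequence.

(** Maps from [Smod F (lo k)] to [N] are the cycles at [lo k]; those extending to [Imod F k] are the
    boundaries. *)
Lemma Ext1_S k N : inhabited (proj_resolution (Smod F (lo k))) ->
  Ext_vanishes 1 (Smod F (hi k)) N <-> exact_at (lo k) N.
Proof.
case=> PK.
have -> := @Ext1_extension L _ _ _ (soc_I (erefl (lo k))) (top_I (erefl (hi k))) 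
   (@projective_I k) _ _ _ PK N.
- split=> [ext x xi xo|ex f].
    have [g gE] := ext (fromS xi xo); exists (g (1, 0)).
    by rewrite -(fromS1 xi xo) gE /= /mklin_fun homI_soc ain_lo.
  have [y fy] := ex _ (homS_ev f) (homS_aout f); exists (fromI k y) => v.
  apply: (homS_eq (g := fromI k y \o soc_I (erefl (lo k)))) => /=.
by rewrite fy ain_lo; exact/esym/fromI_soc.
- by move=> x [].
- move=> [a b]; split=> [/= a0|[x <-]] //.
  by exists b; congr pair.
by move=> y; exists (y, 0).
Qed.

Lemma Ext_S_shift k N (j : nat) : inhabited (proj_resolution (Smod F (lo k))) ->
  Ext_vanishes j.+2 (Smod F (hi k)) N <-> Ext_vanishes j.+1 (Smod F (lo k)) N.
Proof.
case=> PK.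
apply: (@Ext_shift L _ _ _ (soc_I (erefl (lo k))) (top_I (erefl (hi k))) 
   (@projective_I k) _ _ _ PK).
- by move=> x [].
- move=> [a b]; split=> [/= a0|[x <-]] //.
  by exists b; congr pair.
by move=> y; exists (y, 0).
Qed.

End Exactness.

(** * Indecomposable modules and the cluster tilting subcategory *)

Lemma hi_ex n (i : 'I_n) : (0 < i)%N -> exists k, hi k = i.
Proof.
move=> i_gt0; have lt : (i.-1 < n.-1)%N by have := ltn_ord i; lia.
by exists (Ordinal lt); apply: val_inj => /=; lia.
Qed.

Lemma lo_ex n (i : 'I_n) : (i < n.-1)%N -> exists k, lo k = i.
Proof. by move=> lt; exists (Ordinal lt); apply: val_inj. Qed.

Section Classification.
Variables (F : fieldType) (n : nat).
Local Notation L := (Lambda F n).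
Local Notation Lc := (L : pzRingType)^c.
Local Notation ev := (@ev F n).
Local Notation ea := (@ea F n).
Local Notation ain := (@ain F n).
Local Notation aout := (@aout F n).
Implicit Types (M N X : rmodType L) (i j : 'I_n) (k l : 'I_n.-1).

Lemma ain_eq0 i M (x : M) : (forall k, ea k *: x = 0) -> ain i *: x = 0.
Proof.
move=> x0; have [lt|ge] := ltnP i n.-1.
  by have [k <-] := lo_ex lt; rewrite ain_lo.
rewrite (_ : ain i = 0) ?scale0r //; apply: LcP => l; rewrite !lcoefE //.
by rewrite -val_eqE /= (ltn_eqF (leq_trans (ltn_ord l) ge)).
Qed.

Lemma aout_eq0 i M (x : M) : (forall k, ea k *: x = 0) -> aout i *: x = 0.
Proof.
move=> x0; case: (posnP i) => [i0|i_gt0]; first by rewrite aout0 // scale0r.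
by have [k <-] := hi_ex i_gt0; rewrite aout_hi.
Qed.

Lemma base_linear M N (f : {linear M -> N}) : linear (f : base M -> base N).
Proof. by move=> r x y; exact: (linearP f (scal n r) x y). Qed.

Lemma ker_span_lt M X (s : {linear X -> M}) (r : {linear M -> X}) (x : X)
    (v : seq (base M)) :
  cancel s r -> x != 0 -> (forall y, in_span v y) ->
  exists2 w : seq (base (ker_mod r)), (size w < size v)%N &
    forall y, in_span w y.
Proof.
move=> sK x_neq0 vP; have [f [g [fK gK]]] := iso_inv (retract_iso sK).
have [||w wv wP] := span_quotient
    (g := mklin (base_linear (lsnd X (ker_mod r) \o g))) (vP (f (x, 0))).
- apply/eqP => e; case/eqP: x_neq0.
  by have := fK (x, 0); rewrite [f _]e linear0 => -[].
- by rewrite /= /mklin_fun /= fK.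
exists w => // y; have := wP _ (vP (f (0, y))).
by rewrite /= /mklin_fun /= fK.
Qed.

(** Splits off one nonzero summand at a time, an [Imod] if some arrow acts nontrivially and a simple
    otherwise; the complement has a shorter spanning sequence. It serves for both the cluster
    tilting subcategory and a torsion class. *)
Lemma module_ind (C P : modclass L) :
  (forall M, C M -> finitely_generated M) ->
  (forall X M, retract X M -> C M -> C X) ->
  (forall M N, isomorphic M N -> P M -> P N) ->
  (forall M, zero_module M -> P M) ->
  (forall M N, C (M * N)%type -> P M -> P N -> P (M * N)%type) ->
  (forall i, C (Smod F i) -> P (Smod F i)) ->
  (forall k, C (Imod F k) -> P (Imod F k)) ->
  forall M, C M -> P M.
Proof.
move=> Cfg Cret Piso P0 Psum PS PI M CM.
have [v vP] := fg_span (Cfg M CM).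
have [m] := ubnP (size v); elim: m M CM v vP => // m IH M CM v vP; rewrite ltnS => vm.
have step X (s : {linear X -> M}) (r : {linear M -> X}) (x : X) :
    cancel s r -> x != 0 -> P X -> P M.
  move=> sK x_neq0 PX; have [w wv wP] := ker_span_lt sK x_neq0 vP.
  apply: Piso (retract_iso sK) _; apply: Psum PX _.
    apply: Cret CM; have [f [g [fK gK]]] := iso_inv (retract_iso sK).
    by exists f, g.
  apply: IH wP (leq_trans wv vm).
  apply: Cret CM; have [f [g [fK gK]]] := iso_inv (retract_iso sK).
  exists (f \o linr X (ker_mod r)), (lsnd X (ker_mod r) \o g) => y /=.
  by rewrite fK.
have [M0|/not_all_ex_not[x /eqP x_neq0]] := classic (zero_module M).
  exact: P0.
have [[k [y ky]]|noarrow] := classic (exists k (y : M), ea k *: y != 0).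
  have XM := split_I (Cfg M CM) ky; have [s [r sK]] := XM.
  apply: step ((1, 0) : Imod F k) sK _ (PI _ (Cret _ _ XM CM)).
  by rewrite xpair_eqE oner_eq0.
have arrow0 k (y : M) : ea k *: y = 0.
  by apply/eqP/negPn/negP => ky; apply: noarrow; exists k, y.
have [i xi] : exists i, ev i *: x != 0.
  apply: NNPP => none; case/eqP: x_neq0; apply: ev_eq0 => i.
  by apply/eqP/negPn/negP => xi; apply: none; exists i.
(* All arrows act as zero, so [ev i *: x] is a cycle and no boundary. *)
have XM : retract (Smod F i) M.
  apply: split_S; first exact: Cfg.
  move=> /(_ (ev i *: x))[||y]; first exact: ev_ev.
    by apply: aout_eq0.
  by rewrite ain_eq0 // => /eqP; rewrite (negPf xi).
have [s [r sK]] := XM.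
apply: step ((1 : F) : Smod F i) sK _ (PS _ (Cret _ _ XM CM)).
exact: oner_neq0.
Qed.

Lemma resolution_S i : inhabited (proj_resolution (Smod F i)).
Proof.
have [m] := ubnP (i : nat); elim: m i => // m IH i; rewrite ltnS => im.
have [i0|i_gt0] := posnP i.
  by constructor; exact: triv_resolution (projective_S i0).
have [k kE] := hi_ex i_gt0; subst i.
have [PK] := IH (lo k) im; constructor.
refine (@splice_resolution L _ _ _ (soc_I F (erefl (lo k)))
  (top_I F (erefl (hi k))) (@projective_I F n k) _ _ _ PK).
- by move=> x [].
- move=> [a b]; split=> [/= a0|[x <-]] //.
  by exists b; congr pair.
by move=> y; exists (y, 0).
Qed.

(** Dimension shifting down the quiver. If [i <= j], the projective simple at 0 is reached first and
    the right side is vacuous. *)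
Lemma Ext_S (j : nat) i N :
  Ext_vanishes j.+1 (Smod F i) N <->
  forall i' : 'I_n, (i' + j.+1 = i)%N -> exact_at i' N.
Proof.
elim: j i => [|j IH] i; have [i0|i_gt0] := posnP i.
- split=> [_ i' e|_]; first by lia.
  exact: projective_Ext (projective_S i0).
- have [k kE] := hi_ex i_gt0; subst i.
  rewrite (Ext1_S N (resolution_S (lo k))).
  split=> [ex i' e|ex]; last by apply: ex; rewrite /= addn1.
  by rewrite (_ : i' = lo k) //; apply: val_inj; move: e => /=; lia.
- split=> [_ i' e|_]; first by lia.
  exact: projective_Ext (projective_S i0).
have [k kE] := hi_ex i_gt0; subst i.
rewrite (Ext_S_shift N j (resolution_S (lo k))) IH.
by split=> ex i' e; apply: ex; move: e => /=; lia.
Qed.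

End Classification.

Section ClusterTilting.
Variables (F : fieldType) (n d : nat) (CC : modclass (Lambda F n)).
Hypothesis d_ge2 : (2 <= d)%N.
Hypothesis CC_ct : cluster_tilting d CC.
Local Notation L := (Lambda F n).
Implicit Types (M N X : rmodType L) (i j : 'I_n) (k l : 'I_n.-1).

Lemma ct_subcat : subcategory CC. Proof. by case: CC_ct. Qed.
Lemma ct_fg M : CC M -> finitely_generated M.
Proof. exact: subcat_fg ct_subcat _. Qed.
Lemma ct_zero M : zero_module M -> CC M.
Proof. exact: subcat_zero ct_subcat _. Qed.
Lemma ct_sum M N : CC M -> CC N -> CC (M * N)%type.
Proof. exact: subcat_sum ct_subcat _ _. Qed.

Lemma ct_retract X M : retract X M -> CC M -> CC X.
Proof.
move=> [s [r sK]] CM; case: CC_ct => _ _ _ ctr.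
have [fgM ext] := (ctr M).1 CM; apply/ctr; split.
  by apply: (@fg_image _ _ _ r _ fgM) => y; exists (s y); exact: sK.
by case=> // i id N CN; exact: Ext_retract sK (ext _ id N CN).
Qed.

Lemma ct_iso M N : isomorphic M N -> CC M -> CC N.
Proof. exact: subcat_iso ct_subcat _ _. Qed.

Lemma ct_proj M : finitely_generated M -> projective M -> CC M.
Proof.
move=> fgM projM; case: CC_ct => _ _ ctl _; apply/ctl; split=> //.
by case=> // i _ N _; exact: projective_Ext.
Qed.

Lemma ct_reg : CC (reg_mod L).
Proof. exact: ct_proj (@fg_reg L) (@projective_reg L). Qed.

Lemma ct_I k : CC (Imod F k).
Proof. exact: ct_proj (fg_I F k) (@projective_I F n k). Qed.

(** Otherwise [Smod F i] splits off [N] and lies in [CC], although by [Ext_S] it has a nonzero Ext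
    into [Smod F i0] in degree [i - i0 < d]. *)
Lemma ct_exact_between (i0 i : 'I_n) N :
  CC (Smod F i0) -> (i0 < i < i0 + d)%N -> CC N -> exact_at i N.
Proof.
move=> C0 /andP[i0i id] CN; apply: NNPP => not_ex.
have CSi := ct_retract (split_S (ct_fg CN) not_ex) CN.
case: CC_ct => _ _ ctl _; have [_ ext] := (ctl _).1 CSi.
have /ext/(_ _ C0) : (1 <= (i - i0.+1).+1 <= d.-1)%N by lia.
rewrite Ext_S => /(_ i0) => h.
have /exact_at_S : exact_at i0 (Smod F i0) by apply: h; lia.
by rewrite eqxx.
Qed.

(** Ext out of the next multiple of [d], in degrees 1 to [d - 1], is governed by the vertices after
    the previous multiple, where members of [CC] are exact. *)
Lemma ct_S i : (d %| i)%N -> CC (Smod F i).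
Proof.
move=> /dvdnP[q]; elim: q i => [|q IH] i iE.
  by apply: ct_proj (fg_S F i) (projective_S _); rewrite iE.
have lt : (q * d < n)%N by have := ltn_ord i; lia.
have C0 := IH (Ordinal lt) erefl.
case: CC_ct => _ _ ctl _; apply/ctl; split; first exact: fg_S.
case=> // j jd N CN; apply/Ext_S => i' e.
by apply: ct_exact_between C0 _ CN => /=; lia.
Qed.

Lemma ct_exact i N : ~~ (d %| i)%N -> CC N -> exact_at i N.
Proof.
move=> di; have := divn_eq i d.
have r_lt : (i %% d < d)%N by rewrite ltn_mod; lia.
have r_gt : (0 < i %% d)%N by rewrite lt0n.
move=> iE; have lt : (i %/ d * d < n)%N by have := ltn_ord i; lia.
apply: (@ct_exact_between (Ordinal lt)); last by rewrite /=; lia.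
by apply: ct_S; rewrite /= dvdn_mull.
Qed.

Lemma ct_S_dvd i : CC (Smod F i) -> (d %| i)%N.
Proof.
move=> Ci; apply: contraT => di.
by have /exact_at_S := ct_exact di Ci; rewrite eqxx.
Qed.

End ClusterTilting.

(** * Additive classes *)

Section Add.
Variable R : pzRingType.
Implicit Types (M N K : rmodType R) (XX P : modclass R).

Lemma iso_prod M M' N N' :
  isomorphic M M' -> isomorphic N N' -> isomorphic (M * N)%type (M' * N')%type.
Proof.
move=> /iso_inv[f [f' [fK f'K]]] /iso_inv[g [g' [gK g'K]]].
apply: (@isoI _ _ _ (mklin (map_pair_linear f g)) (mklin (map_pair_linear f' g'))).
  by case=> x y; rewrite /= /mklin_fun /= fK gK.
by case=> x y; rewrite /= /mklin_fun /= f'K g'K.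
Qed.

Lemma iso_prodA M N K : isomorphic (M * N * K)%type (M * (N * K))%type.
Proof.
have fL : linear ((fun x => (x.1.1, (x.1.2, x.2))) : M * N * K -> M * (N * K)).
  by [].
have gL : linear ((fun x => (x.1, x.2.1, x.2.2)) : M * (N * K) -> M * N * K).
  by [].
by apply: (@isoI _ _ _ (mklin fL) (mklin gL)) => [[[]]|[? []]].
Qed.

Lemma iso_prodC M N : isomorphic (M * N)%type (N * M)%type.
Proof.
have fL M' N' : linear ((fun x => (x.2, x.1)) : M' * N' -> N' * M') by [].
by apply: (@isoI _ _ _ (mklin (@fL M N)) (mklin (@fL N M))) => [[]|[]].
Qed.

Lemma iso_zero_prod M N : zero_module M -> isomorphic (M * N)%type N.
Proof.
move=> M0; apply: (@isoI _ _ _ (lsnd M N) (linr M N)) => // -[x y].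
by rewrite /= /mklin_fun /= (M0 x).
Qed.

Definition dsum (Ms : seq (rmodType R)) : rmodType R :=
  direct_sum Ms id.

Fixpoint all_in XX (Ms : seq (rmodType R)) : Prop :=
  if Ms is M :: Ms' then XX M /\ all_in XX Ms' else True.

Lemma all_in_cat XX s t : all_in XX s -> all_in XX t -> all_in XX (s ++ t).
Proof. by elim: s => //= M s IH [? ?] ?; split; auto. Qed.

Lemma dsum_cat s t : isomorphic (dsum (s ++ t)) (dsum s * dsum t)%type.
Proof.
elim: s => [|M s IH] /=.
  by apply/iso_sym/iso_zero_prod => x; apply/rowP => -[].
apply: iso_trans (iso_prod (iso_refl M) IH) _.
exact/iso_sym/iso_prodA.
Qed.

Lemma dsum_map (I : Type) (s : seq I) (X_ : I -> rmodType R) :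
  dsum [seq X_ i | i <- s] = direct_sum s X_.
Proof. by elim: s => //= i s IH; rewrite /dsum /= -/(dsum _) IH. Qed.

Lemma addP XX M :
  add XX M <-> exists Ms N, all_in XX Ms /\ isomorphic (M * N)%type (dsum Ms).
Proof.
split=> [[m [X_ [N [XXX iso]]]]|[Ms [N [XXMs iso]]]].
  exists [seq X_ i | i <- enum 'I_m], N; split.
    by elim: (enum 'I_m) => //= i s IH.
  by rewrite dsum_map.
pose X_ (i : 'I_(size Ms)) := nth (zero_mod R) Ms i.
exists (size Ms), X_, N; split.
  rewrite /X_ => -[i /= ltis]; elim: Ms XXMs i ltis {iso X_} => //= K Ms IH [XK XMs].
  by case=> //= i; exact: IH.
suff -> : direct_sum (enum 'I_(size Ms)) X_ = dsum Ms by [].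
rewrite -[in RHS](mkseq_nth (zero_mod R) Ms) /mkseq.
by rewrite -val_enum_ord -map_comp dsum_map.
Qed.

Lemma add_sub XX M : XX M -> add XX M.
Proof.
move=> XM; apply/addP; exists [:: M], (zero_mod R); split=> //=.
exact: iso_refl.
Qed.

Lemma add_iso XX M N : isomorphic M N -> add XX M -> add XX N.
Proof.
move=> MN /addP[Ms [K [XMs iso]]]; apply/addP; exists Ms, K; split=> //.
exact: iso_trans (iso_prod (iso_sym MN) (iso_refl K)) iso.
Qed.

Lemma add_summand XX M N : add XX (M * N)%type -> add XX M.
Proof.
move=> /addP[Ms [K [XMs iso]]]; apply/addP; exists Ms, (N * K)%type.
by split=> //; exact: iso_trans (iso_sym (iso_prodA _ _ _)) iso.
Qed.

Lemma add_zero XX M : zero_module M -> add XX M.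
Proof.
move=> M0; apply/addP; exists [::], (zero_mod R); split=> //=.
exact: iso_zero_prod.
Qed.

Lemma add_sum XX M N : add XX M -> add XX N -> add XX (M * N)%type.
Proof.
move=> /addP[Ms [K [XMs iso]]] /addP[Ns [K' [XNs iso']]].
apply/addP; exists (Ms ++ Ns), (K * K')%type; split; first exact: all_in_cat.
apply: iso_trans (iso_sym (dsum_cat _ _)); apply: iso_trans (iso_prod iso iso').
have fL (A B C D : rmodType R) : linear ((fun x => ((x.1.1, x.2.1), (x.1.2, x.2.2))) :
    A * B * (C * D) -> A * C * (B * D)) by [].
by apply: (@isoI _ _ _ (mklin (fL _ _ _ _)) (mklin (fL _ _ _ _))) => [[[? ?] []]|[[? ?] []]].
Qed.

Record additive_class P : Prop := AdditiveClass {
  addc_iso : forall M N, isomorphic M N -> P M -> P N;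
  addc_zero : forall M, zero_module M -> P M;
  addc_sum : forall M N, P M -> P N -> P (M * N)%type;
  addc_summand : forall M N, P (M * N)%type -> P M }.

Lemma add_additive XX : additive_class (add XX).
Proof.
split; [exact: add_iso | exact: add_zero | exact: add_sum | exact: add_summand].
Qed.

Lemma dsum_in P Ms : additive_class P -> all_in P Ms -> P (dsum Ms).
Proof.
move=> Pa; elim: Ms => [_|M Ms IH [PM /IH PMs]] /=.
  by apply: addc_zero => // x; apply/rowP => -[].
exact: addc_sum.
Qed.

Lemma add_min XX P :
  additive_class P -> (forall M, XX M -> P M) -> forall M, add XX M -> P M.
Proof.
move=> Pa XP M /addP[Ms [N [XMs iso]]].
apply: (addc_summand Pa (N := N)); apply: addc_iso (iso_sym iso) _ => //.
by apply: dsum_in => //; elim: Ms XMs {iso} => //= K Ms IH [XK XMs]; split; auto.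
Qed.

End Add.

Section AddLambda.
Variables (F : fieldType) (n : nat).
Local Notation L := (Lambda F n).
Implicit Types (M N X : rmodType L) (i j : 'I_n) (k l : 'I_n.-1).

Lemma additive_retractI (P : modclass L) :
  (forall X M, retract X M -> P M -> P X) ->
  (forall M, zero_module M -> P M) ->
  (forall M N, P M -> P N -> P (M * N)%type) -> additive_class P.
Proof.
move=> Pret P0 Psum; split=> // M N.
  move=> /iso_inv[f [g [fK gK]]]; apply: Pret; by exists g, f.
by apply: Pret; exists (linl M N), (lfst M N).
Qed.

Lemma additive_exact_at i : additive_class (@exact_at F n i).
Proof.
apply: additive_retractI; first exact: exact_at_retract; last exact: exact_at_sum.
by move=> M M0 x _ _; exists 0; rewrite (M0 x) scaler0.
Qed.

Lemma additive_killed k :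
  additive_class (fun M => forall x : M, ea F k *: x = 0).
Proof.
apply: additive_retractI.
- move=> X M [s [r sK]] M0 x; have := congr1 r (M0 (s x)).
  by rewrite linear0 => <-; rewrite -{1}(sK x) -linearZ.
- by move=> M M0 x; exact: M0.
by move=> M N M0 N0 [x y]; congr pair; [exact: M0 | exact: N0].
Qed.

Lemma additive_no_hom X :
  additive_class (fun M => forall (h : {linear M -> X}) x, h x = 0).
Proof.
apply: additive_retractI.
- by move=> Y M [s [r sK]] M0 h x; have /= := M0 (h \o r) (s x); rewrite sK.
- by move=> M M0 h x; rewrite (M0 x) linear0.
move=> M N M0 N0 h [x y].
have -> : (x, y) = linl M N x + linr M N y by congr pair; rewrite /= ?addr0 ?add0r.
rewrite linearD; have /= -> := M0 (h \o linl M N) x.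
by have /= -> := N0 (h \o linr M N) y; rewrite addr0.
Qed.

End AddLambda.

(** * Paths and their subcategories *)

Section PathSubcategory.
Variables (F : fieldType) (n d p : nat).
Local Notation L := (Lambda F n).
Implicit Types (chi : Gwalk d p).

Lemma direct_sum_summand (P : modclass L) (I : eqType) (s : seq I)
    (X_ : I -> rmodType L) i :
  additive_class P -> i \in s -> P (direct_sum s X_) -> P (X_ i).
Proof.
move=> Pa; elim: s => //= j s IH; rewrite inE => /predU1P[->|/IH{}IH].
  exact: addc_summand.
by move=> /(addc_iso Pa (iso_prodC _ _))/(addc_summand Pa).
Qed.

Lemma direct_sum_in (P : modclass L) (I : eqType) (s : seq I)
    (X_ : I -> rmodType L) :
  additive_class P -> (forall i, i \in s -> P (X_ i)) -> P (direct_sum s X_).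
Proof.
move=> Pa; elim: s => /= [_|j s IH Ps].
  by apply: addc_zero => // x; apply/rowP => -[].
apply: addc_sum => //; first by apply: Ps; rewrite mem_head.
by apply: IH => i is_; apply: Ps; rewrite inE is_ orbT.
Qed.

Lemma U_additive chi : additive_class (U_of F n chi).
Proof. exact: add_additive. Qed.

Lemma U_S chi (j : 'I_p) (i : 'I_n) :
  chi.1 j = DD -> i = (j * d)%N :> nat -> U_of F n chi (Smod F i).
Proof.
move=> chij iE; apply: add_sub; left; exists j; rewrite /U_ chij.
by apply: add_sub; exists i.
Qed.

Lemma U_I chi (k : 'I_n.-1) : k \in Q_ n chi -> U_of F n chi (Imod F k).
Proof.
move=> kQ; apply: (direct_sum_summand (s := enum (Q_ n chi)) (X_ := @Imod F n)).
- exact: U_additive.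
- by rewrite mem_enum.
by apply: add_sub; right.
Qed.

Lemma U_min chi (P : modclass L) :
  additive_class P ->
  (forall (j : 'I_p) (i : 'I_n), chi.1 j = DD -> i = (j * d)%N :> nat ->
     P (Smod F i)) ->
  (forall k, k \in Q_ n chi -> P (Imod F k)) ->
  forall M, U_of F n chi M -> P M.
Proof.
move=> Pa PS PI; apply: add_min => // M [[j]|->].
  rewrite /U_; case chij: (chi.1 j); first exact: addc_zero.
  by apply: add_min => // N [i iE ->]; exact: PS iE.
by apply: direct_sum_in => // k; rewrite mem_enum; exact: PI.
Qed.

(** If the vertex [j] were [Ddown0], all generators, hence all members, would be exact at [i];
    [Smod F i] is not. *)
Lemma U_S_inv chi (j : 'I_p) (i : 'I_n) :
  (0 < d)%N -> U_of F n chi (Smod F i) -> i = (j * d)%N :> nat -> chi.1 j = DD.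
Proof.
move=> d_gt0 Ui iE; case chij: (chi.1 j) => //.
have /exact_at_S : exact_at i (Smod F i); last by rewrite eqxx.
move: Ui; apply: (U_min (P := @exact_at F n i)) => [|j' i' chij' i'E|k _].
- exact: additive_exact_at.
- apply/exact_at_S; apply/eqP => ii'.
  suff jj' : j = j' by rewrite jj' chij' in chij.
  apply: val_inj; apply/eqP.
  by rewrite -(eqn_pmul2r d_gt0) /= -iE ii' i'E.
exact: exact_at_I.
Qed.

(** Among the possible generators only [Imod F k] is not killed by the arrow [k], and being killed
    passes to sums and summands. *)
Lemma U_I_inv chi (k : 'I_n.-1) : U_of F n chi (Imod F k) -> k \in Q_ n chi.
Proof.
move=> Uk; apply: contraT => kQ.
have : forall x : Imod F k, (ea F k *: x = 0)%R.
  move: Uk; apply: (U_min (P := fun M => forall x : M, ea F k *: x = 0)%R) => [|j i _ _ x|l lQ x].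
  - exact: additive_killed.
  - by rewrite SactE lcoefE mulr0.
  rewrite IactE !lcoefE !mulr0 addr0 (_ : (l == k) = false) ?mulr0 //.
  by apply: contraNF kQ => /eqP <-.
move=> /(_ (1, 0)%R); rewrite IactE !lcoefE eqxx /= => /(congr1 snd) /eqP /=.
by rewrite mul0r addr0 mulr1 oner_eq0.
Qed.

End PathSubcategory.

(** * Paths as solutions of the closure conditions *)

Section Profile.
Variables (n d p : nat).
Hypothesis d_ge2 : (2 <= d)%N.
Implicit Types (chi : Gwalk d p) (j : 'I_p.-1) (k l : 'I_n.-1).

Definition arrow_block (a : Garrow d) (j k : nat) : bool :=
  match a with
  | Beta | Gamma => false
  | Delta y _ => (j.+1 * d - y <= k < j.+1 * d)%N
  | Epsilon => (j * d <= k < j.+1 * d)%N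
  end.

Lemma arrow_block_bound a j k : arrow_block a j k -> (j * d <= k < j.+1 * d)%N.
Proof. by case: a => //= y yd; rewrite mulSn; lia. Qed.

Lemma QP chi j k : (j * d <= k < j.+1 * d)%N ->
  (k \in Q_ n chi) = arrow_block (chi.2 j) j k.
Proof.
move=> kj; rewrite inE; apply/existsP/idP => [[j' kj']|kj']; last by exists j.
have kj'd := arrow_block_bound kj'.
suff -> : j = j' by [].
apply: val_inj => /=.
have jE (i : nat) : (i * d <= k < i.+1 * d)%N -> i = (k %/ d)%N.
  have d_gt0 : (0 < d)%N by lia.
  move=> /andP[ik ki]; apply/eqP.
  by rewrite eqn_leq leq_divRL // ik /= -ltnS ltn_divLR.
by rewrite (jE j) // (jE j').
Qed.

Hypothesis n_eq : n = ((p - 1) * d + 1)%N.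

Lemma block_ex k : exists j, (j * d <= k < j.+1 * d)%N.
Proof.
have k_lt := ltn_ord k.
have d_gt0 : (0 < d)%N by lia.
have lt : (k %/ d < p.-1)%N by rewrite ltn_divLR //; lia.
exists (Ordinal lt) => /=; rewrite leq_trunc_div /= mulSn.
have := divn_eq k d; have := ltn_pmod k d_gt0; lia.
Qed.

(** The conditions are those of [tor_top], [tor_step] and [tor_socle], in this order. *)
Definition is_profile (V : 'I_p -> Gvertex) (Q : {set 'I_n.-1}) : Prop :=
  [/\ forall k, k \in Q -> forall i : 'I_p, k.+1 = (i * d)%N -> V i = DD,
      forall k l, k \in Q -> l = k.+1 :> nat -> ~~ (d %| l)%N -> l \in Q
    & forall j k, V (lo j) = DD -> V (hi j) = DD -> k = (j * d)%N :> nat ->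
        k \in Q].

Lemma path_profile chi : Gpath chi -> is_profile chi.1 (Q_ n chi).
Proof.
move=> chiP; split.
- move=> k kQ i kE; have [j jk] := block_ex k.
  have [_ tE] := chiP j; rewrite (QP chi jk) in kQ.
  have -> : i = hi j.
    by apply: val_inj => /=; move: jk; rewrite kE; nia.
  by rewrite -tE; case: (chi.2 j) kQ.
- move=> k l kQ lE dl; have [j jk] := block_ex k.
  have jl : (j * d <= l < j.+1 * d)%N.
    have : l <> (j.+1 * d)%N :> nat by move=> e; rewrite e dvdn_mull in dl.
    by move: jk; rewrite lE; lia.
  rewrite (QP chi jl); rewrite (QP chi jk) in kQ.
  by case: (chi.2 j) kQ jl => //= y yd; lia.
move=> j k Vlo Vhi kE; have jk : (j * d <= k < j.+1 * d)%N by rewrite kE mulSn; lia.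
rewrite (QP chi jk); have [sE tE] := chiP j.
by rewrite Vlo in sE; rewrite Vhi in tE; case: (chi.2 j) sE tE.
Qed.

(** Within a block [Q] is closed upwards, so it is an end segment. If nonempty, it forces [DD] at
    the end of the block, and the start selects [Delta] or [Epsilon]; if empty, the arrow is
    [Gamma], [Beta] or [Delta] with [y = 0]. *)
Lemma profile_path V Q : is_profile V Q ->
  exists2 chi : Gwalk d p, Gpath chi & chi.1 =1 V /\ Q_ n chi = Q.
Proof.
move=> [P1 P2 P3].
have up j k l : (j * d <= k)%N -> (k <= l)%N -> (l < j.+1 * d)%N ->
    k \in Q -> l \in Q.
  move=> jk kl lj kQ; have [m] := ubnP (l - k)%N.
  elim: m l kl lj => // m IH l kl lj lkm.
  have [e|kl'] := eqVneq (k : nat) l; first by rewrite -(val_inj e).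
  have lt : (l.-1 < n.-1)%N by have := ltn_ord l; lia.
  apply: (P2 (Ordinal lt)) => /=; last 1 first.
  - apply/negP => /dvdnP[q qE]; rewrite qE in lj kl'.
    have q_lt : (q < j.+1)%N by move: lj; rewrite ltn_pmul2r //; lia.
    have : (q * d <= j * d)%N by rewrite leq_mul2r -ltnS q_lt orbT.
    lia.
  - by apply: IH => /=; lia.
  by lia.
have arrowP j : exists a : Garrow d, [/\ Gsrc a = V (lo j), Gtgt a = V (hi j)
    & forall k, (j * d <= k < j.+1 * d)%N -> (k \in Q) = arrow_block a j k].
  have j_lt := ltn_ord j.
  have jd_lt : (j.+1 * d <= n.-1)%N.
    rewrite (_ : n.-1 = p.-1 * d)%N; first by rewrite leq_mul2r j_lt orbT.
    by rewrite n_eq addn1 subn1.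
  have jdS : (j.+1 * d = j * d + d)%N by rewrite mulSn addnC.
  pose inb m := [exists k : 'I_n.-1, [&& k == m :> nat, j * d <= m, m < j.+1 * d & k \in Q]]%N.
  have [[m0 m0P]|none] := classic (exists m, inb m); last first.
    have Qn k : (j * d <= k < j.+1 * d)%N -> (k \in Q) = false.
      move=> /andP[jk kj]; apply: contra_notF none => kQ; exists k.
      by apply/existsP; exists k; rewrite eqxx jk kj.
    case Vlo: (V (lo j)); case Vhi: (V (hi j)).
    - by exists (Gamma d); split=> // k /Qn ->.
    - by exists (Delta (leq0n d)); split=> // k kj; rewrite Qn //=; lia.
    - by exists (Beta d); split=> // k /Qn ->.
    (* With [DD] at both ends the third condition puts the first element of the block in [Q], so the
       block is not empty. *)
    have lt : (j * d < n.-1)%N by lia.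
    have := P3 j (Ordinal lt) Vlo Vhi erefl.
    by rewrite Qn //=; lia.
  have [m /existsP[k /and4P[/eqP kE jm mj kQ]] m_min] := ex_minnP (ex_intro _ m0 m0P).
  have Vhi : V (hi j) = DD.
    have lt : ((j.+1 * d).-1 < n.-1)%N by lia.
    apply: (P1 (Ordinal lt)) => /=; last by lia.
    by apply: (up j k) => //=; lia.
  case Vlo: (V (lo j)).
    (* [y] counts the elements from the least one, [m], to the end of the block. *)
    have yd : (j.+1 * d - m <= d)%N by lia.
    exists (Delta yd); split=> // l /andP[jl lj] /=.
    apply/idP/idP => [lQ|/andP[ml _]]; last by apply: (up j k) => //; lia.
    rewrite lj andbT; suff : (m <= l)%N by lia.
    by apply: m_min; apply/existsP; exists l; rewrite eqxx jl lj.
  exists (Epsilon d); split=> // l /andP[jl lj] /=; rewrite jl lj /=.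
  have lt : (j * d < n.-1)%N by lia.
  by apply: (up j (Ordinal lt)) => //=; apply: (P3 j).
have [a aP] := fin_all_exists arrowP.
pose chi : Gwalk d p := ([ffun i => V i], [ffun j => a j]).
exists chi.
  by move=> j; rewrite !ffunE; have [-> ->] := aP j.
split=> [i|]; first by rewrite ffunE.
apply/setP => k; have [j jk] := block_ex k.
by rewrite (QP chi jk) ffunE; have [_ _ ->] := aP j.
Qed.

(** Source and target determine an arrow up to the index of [Delta], and that index is the size of
    the part of [Q_] in the block. *)
Lemma path_inj chi chi' : Gpath chi -> Gpath chi' ->
  chi.1 =1 chi'.1 -> Q_ n chi = Q_ n chi' -> chi = chi'.
Proof.
move=> chiP chi'P V_eq Q_eq.
suff e j : chi.2 j = chi'.2 j.
  case: chi chi' V_eq e {chiP chi'P Q_eq} => v a [v' a'] /= V_eq e.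
  by congr pair; apply/ffunP.
have j_lt := ltn_ord j.
have jd_lt : (j.+1 * d <= n.-1)%N.
  rewrite (_ : n.-1 = p.-1 * d)%N; first by rewrite leq_mul2r j_lt orbT.
  by rewrite n_eq addn1 subn1.
have jdS : (j.+1 * d = j * d + d)%N by rewrite mulSn addnC.
have block_eq (k : nat) : (j * d <= k < j.+1 * d)%N ->
    arrow_block (chi.2 j) j k = arrow_block (chi'.2 j) j k.
  move=> kj; have lt : (k < n.-1)%N by lia.
  by rewrite -(QP chi (k := Ordinal lt)) // -(QP chi' (k := Ordinal lt)) // Q_eq.
have [sE tE] := chiP j; have [s'E t'E] := chi'P j.
rewrite V_eq in sE; rewrite V_eq in tE; rewrite -s'E in sE; rewrite -t'E in tE.
case: (chi.2 j) (chi'.2 j) sE tE block_eq => [|||y yd] [|||y' y'd] //= _ _ yy'.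
suff e : y = y' by subst y'; congr Delta; exact: bool_irrelevance.
apply/eqP; rewrite eqn_leq; apply/andP; split; rewrite leqNgt; apply/negP => lt.
  by have := yy' (j.+1 * d - y)%N; lia.
by have := yy' (j.+1 * d - y')%N; lia.
Qed.

End Profile.

(** * Torsion classes are closed *)

Section TorsionClass.
Variables (F : fieldType) (n d : nat) (CC UU : modclass (Lambda F n)).
Hypothesis d_ge2 : (2 <= d)%N.
Hypothesis CC_ct : cluster_tilting d CC.
Hypothesis UU_tor : d_torsion d CC UU.
Local Notation L := (Lambda F n).
Local Notation ev := (@ev F n).
Local Notation ea := (@ea F n).
Local Notation ain := (@ain F n).
Local Notation aout := (@aout F n).
Implicit Types (M N X C U : rmodType L).

Lemma tor_sub M : UU M -> CC M. Proof. by case: UU_tor => _ + _; exact. Qed.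

Lemma tor_iso M N : isomorphic M N -> UU M -> UU N.
Proof. by case: UU_tor => /subcat_iso + _ _; exact. Qed.

Section Extension.
Variables (A : nat -> rmodType L) (f : forall i, {linear A i -> A i.+1}).
Hypothesis Aext : d_extension CC d f.

Lemma ext_comp i (x : A i) : (0 < i)%N -> (i < d)%N -> f i.+1 (f i x) = 0.
Proof.
case: Aext => _ [wc1 wc2] _ i_gt0 id.
have [e|lt] := eqVneq i.+1 d; first by have [[-> _] _] := wc2 _ e.
by have [-> _] := wc1 i ltac:(lia).
Qed.

(** Elements are maps from the regular module, which lies in [CC]; tested on it, kernels and weak
    kernels yield injectivity and exactness on elements. *)
Lemma ext_mono x : f 0 x = 0 -> x = 0.
Proof.
case: Aext => _ _ [[_ uniq] _] fx.
have := uniq _ (ct_reg CC_ct) (reg_map x) \0.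
move=> /(_ _ (1 : L^c)) /=; rewrite /mklin_fun scale1r; apply.
by move=> c; rewrite /= /mklin_fun linearZ /= fx scaler0 linear0.
Qed.

Lemma ext_exact i (y : A i.+1) : (i < d)%N -> f i.+1 y = 0 -> exists x, y = f i x.
Proof.
case: Aext => _ _ [[wk0 _] wk] id fy.
have [_ wki] : weak_kernel CC (f i) (f i.+1) by case: i id {y fy} => // i /wk; exact.
have [|h hE] := wki _ (ct_reg CC_ct) (reg_map y).
  by move=> c; rewrite /= /mklin_fun linearZ /= fy scaler0.
by exists (h (1 : L^c)); have /= := hE (1 : L^c); rewrite /mklin_fun scale1r.
Qed.

Lemma ext_zero : (forall x, f 1 x = 0) -> UU (A 0) -> UU (A 1).
Proof.
move=> f1; apply: tor_iso; case: Aext => CA _ [[[_ wk] _] _].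
have [//|h hE] := wk _ (CA 1%N isT) idfun.
exists (f 0); exists h => x; last by have /= <- := hE x.
apply/eqP; rewrite -subr_eq0; apply/eqP/ext_mono.
by rewrite linearB /=; have /= <- := hE (f 0 x); rewrite subrr.
Qed.

(** [f 1 \o g] is killed by [f 2], hence zero by injectivity at the start of the Hom sequence; the
    kernel property then factors [g]. *)
Lemma ext_factor U (g : {linear U -> A 1}) : UU U -> Hom_exact d f U ->
  (forall x, f 1 (g x) = 0) /\ exists h : {linear U -> A 0}, forall x, g x = f 0 (h x).
Proof.
move=> UUU [inj _ _].
have fg0 x : f 1 (g x) = 0.
  by apply: (inj (f 1 \o g)) => y /=; rewrite ext_comp //; lia.
split=> //; case: Aext => _ _ [[[_ wk] _] _].
by have [//|h hE] := wk _ (tor_sub UUU) g; exists h.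
Qed.

End Extension.

Lemma tor_approx C : CC C -> exists (A0 : rmodType L) (f0 : {linear A0 -> C}),
  [/\ UU A0, forall x, f0 x = 0 -> x = 0 &
   forall U (g : {linear U -> C}), UU U ->
     exists h : {linear U -> A0}, forall x, g x = f0 (h x)].
Proof.
case: UU_tor => _ _ ext /ext[A [f [Aext UA0 eqC homA]]]; subst C.
exists (A 0), (f 0); split=> // [x|U g UUU]; first exact: ext_mono.
by have [] := ext_factor Aext g UUU (homA _ UUU).
Qed.

(** In the torsion sequence of [X], the map [f 1] kills the image of [g], which is all of [X]. *)
Lemma tor_quotient U X (g : {linear U -> X}) :
  CC X -> UU U -> (forall y, exists x, g x = y) -> UU X.
Proof.
case: UU_tor => _ _ ext /ext[A [f [Aext UA0 eqX homA]]] UUU; subst X => g_surj.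
apply: (ext_zero Aext) => // y; have [x <-] := g_surj y.
by have [] := ext_factor Aext g UUU (homA _ UUU).
Qed.

Lemma tor_retract X M : retract X M -> UU M -> UU X.
Proof.
move=> XM UM; have CX := ct_retract CC_ct XM (tor_sub UM).
have [s [r sK]] := XM; apply: (tor_quotient (g := r)) UM _ => // y.
by exists (s y); exact: sK.
Qed.

Lemma tor_additive : additive_class UU.
Proof.
by case: UU_tor => -[_ _ U0 Usum] _ _; apply: additive_retractI => //; exact: tor_retract.
Qed.

Lemma tor_top (k : 'I_n.-1) : UU (Imod F k) -> (d %| k.+1)%N -> UU (Smod F (hi k)).
Proof.
move=> Uk dk; apply: (tor_quotient (g := top_I F (erefl (hi k)))) Uk _.
  exact: (ct_S d_ge2 CC_ct).
by move=> y; exists (y, 0).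
Qed.

(** The map from [Imod F k] onto the socle of [Imod F l] lifts to the torsion part [A0] of
    [Imod F l]. Exactness of [A0] at [lo l] makes the lifted socle vector the image of some [y]
    under the arrow [l], and [y] spans off a copy of [Imod F l]. *)
Lemma tor_step (k l : 'I_n.-1) :
  UU (Imod F k) -> l = k.+1 :> nat -> ~~ (d %| l)%N -> UU (Imod F l).
Proof.
move=> Uk lk dl; have e : hi k = lo l by apply: val_inj.
have [A0 [f0 [UA0 f0_inj f0_lift]]] := tor_approx (ct_I CC_ct l).
have [h hE] := f0_lift _ (step_I F e) Uk.
pose x0 := h (1, 0); have fx0 : f0 x0 = (0, 1) by rewrite -hE.
have [||y yE] := @ct_exact _ _ _ CC d_ge2 CC_ct (lo l) _ dl (tor_sub UA0) x0.
- by rewrite -e /x0 -homI_gen.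
- rewrite -e aout_hi; apply: f0_inj; rewrite linearZ /= fx0.
  rewrite IactE !lcoefE (_ : (l == k) = false) ?mul0r ?mulr0 ?addr0 //.
  by rewrite -val_eqE /= lk gtn_eqF.
have fy : (f0 y).1 = 1.
  have := congr1 f0 yE; rewrite linearZ /= fx0 ain_lo IactE !lcoefE eqxx ?mulr1 ?mulr0.
  by rewrite addr0 => -[].
apply: tor_retract UA0; exists (fromI l (ev (hi l) *: y)), f0 => v.
apply: (homI_eq (f := f0 \o fromI l (ev (hi l) *: y)) (g := idfun)) => /=.
rewrite [fromI _ _ _]fromI_gen ev_ev linearZ /= IactE !lcoefE eqxx fy.
by rewrite eq_sym (negPf (hi_lo_neq l)) !mulr0 addr0 mulr1.
Qed.

Lemma aout_ea (v : 'I_n) (l : 'I_n.-1) M (x : M) : aout v *: (ea l *: x) = 0.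
Proof. by apply: aout_eq0 => k; exact: ea_ea. Qed.

(* Chase [y] down to [A d.+1], where it is corrected by the torsion submodule, *)
(* and carry the correction back up to [A i].                                  *)
Lemma ext_correct (A : nat -> rmodType L) (f : forall i, {linear A i -> A i.+1})
    (i0 i1 : 'I_n) :
  d_extension CC d f -> (forall U, UU U -> Hom_exact d f U) ->
  (d %| i0)%N -> i1 = (i0 + d)%N :> nat -> UU (Smod F i1) ->
  forall i (v : 'I_n) (y : A i), (0 < i <= d)%N -> v = (i0 + i)%N :> nat ->
    ev v *: y = y -> aout v *: f i y = 0 ->
    exists y', [/\ ev v *: y' = y', f i y' = 0 & aout v *: y' = aout v *: y].
Proof.
move=> Aext homA di0 i1E US1 i.
have [m] := ubnP (d - i)%N; elim: m i => // m IH i im v y /andP[i_gt0 id] vE yv fy0.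
have [ed|lt] := eqVneq i d.
  subst i; have ev1 : v = i1 by apply: val_inj => /=; rewrite vE.
  subst v; have zv : ev i1 *: f d y = f d y by rewrite -linearZ /= yv.
  have [_ _ surj] := homA _ US1.
  (* At the last place [f d y] is a cycle, that is, a map from the torsion module [Smod F i1], and
     it lifts through [f d]. *)
  have [g gE] := surj (fromS zv fy0).
  exists (y - g (1 : F)); split.
  - by rewrite scalerBr yv homS_ev.
  - by rewrite linearB /=; have := gE (1 : F); rewrite fromS1 => /= <-; rewrite subrr.
  by rewrite scalerBr homS_aout subr0.
(* [v] lies strictly between two consecutive multiples of [d], so the terms are exact there. *)
have dv : ~~ (d %| v)%N.
  by rewrite vE dvdn_addr //; apply/negP => /dvdn_leq; lia.
have CA : CC (A i.+1) by case: Aext => + _ _; apply; lia.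
have [||Y YE] := @ct_exact _ _ _ CC d_ge2 CC_ct v _ dv CA (f i y).
- by rewrite -linearZ /= yv.
- by [].
have [l lE] : exists l, lo l = v by apply: lo_ex; have := ltn_ord i1; lia.
subst v; rewrite ain_lo -ea_ev in YE.
have [|||||Y' [Yv fY YY]] := IH i.+1 _ (hi l) (ev (hi l) *: Y).
- by lia.
- by lia.
- by move: vE => /=; lia.
- exact: ev_ev.
- by rewrite aout_hi -linearZ -YE /= ext_comp //; lia.
(* The corrected [Y'] comes from [A i]; subtracting [ea l *: t] leaves [aout v *: y] unchanged, as
   two arrows compose to zero. *)
have [|t tE] := ext_exact Aext (i := i) _ fY; first by lia.
exists (y - ea l *: t); split.
- by rewrite scalerBr yv ev_ea.
- rewrite linearB linearZ /= -tE.
  by move: YY; rewrite aout_hi -YE => ->; rewrite subrr.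
by rewrite scalerBr aout_ea subr0.
Qed.

(** The vector [ea k *: u] is the image of a torsion simple, so [f 1] kills it; [ext_correct]
    replaces [u] by a [u'] killed by [f 1]. As [u'] generates [C], [f 1] is zero. Keeping [C] a
    variable allows substitution along [A 1 = C]. *)
Lemma tor_fill C (i0 i1 : 'I_n) (k : 'I_n.-1) (u : C) :
  CC C -> UU (Smod F i0) -> UU (Smod F i1) ->
  (d %| i0)%N -> i1 = (i0 + d)%N :> nat -> lo k = i0 -> ev (hi k) *: u = u ->
  (forall u', ev (hi k) *: u' = u' -> ea k *: u' = ea k *: u ->
     forall z, exists c : L^c, z = c *: u') ->
  UU C.
Proof.
case: UU_tor => _ _ ext /ext[A [f [Aext UA0 eqC homA]]] US0 US1; subst C.
move=> di0 i1E kE uv gen; subst i0.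
have wv : ev (lo k) *: (ea k *: u) = ea k *: u by exact: ev_ea.
have wo : aout (lo k) *: (ea k *: u) = 0 by exact: aout_ea.
have [fw _] := ext_factor Aext (fromS wv wo) US0 (homA _ US0).
have {}fw := fw (1 : F); rewrite fromS1 in fw.
have [||||u' [u'v fu' u'u]] := ext_correct Aext homA di0 i1E US1 (i := 1) (v := hi k) (y := u).
- by lia.
- by rewrite /= addn1.
- by [].
- by rewrite aout_hi -linearZ.
apply: (ext_zero Aext) => // z.
rewrite !aout_hi in u'u; have [c ->] := gen _ u'v u'u z.
by rewrite linearZ /= fu' scaler0.
Qed.

Lemma tor_socle (i0 i1 : 'I_n) (k : 'I_n.-1) :
  UU (Smod F i0) -> UU (Smod F i1) ->
  (d %| i0)%N -> i1 = (i0 + d)%N :> nat -> lo k = i0 -> UU (Imod F k).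
Proof.
move=> US0 US1 di0 i1E kE.
apply: (tor_fill (u := ((1, 0) : Imod F k)) (ct_I CC_ct k) US0 US1 di0 i1E kE).
  rewrite IactE !lcoefE eqxx eq_sym (negPf (hi_lo_neq k)) ?mulr0 ?mulr1 ?addr0 //.
case=> a b; rewrite !IactE !lcoefE !eqxx eq_sym (negPf (hi_lo_neq k)) /=.
rewrite !mulr0 !mulr1 !addr0 => -[<-] [->] z.
by exists (gen_coef z); exact: gen_coefP.
Qed.

End TorsionClass.

(** * Torsion sequences *)

Section ExtensionOperations.
Variables (R : pzRingType) (CC : modclass R) (d : nat).
Implicit Types (A B C D M N X : rmodType R).

Lemma d_extension_iso (A A' : nat -> rmodType R)
    (f : forall i, {linear A i -> A i.+1}) (to : forall i, {linear A i -> A' i})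
    (fr : forall i, {linear A' i -> A i}) :
  (forall i, cancel (to i) (fr i)) -> (forall i, cancel (fr i) (to i)) ->
  (forall i, (i <= d.+1)%N -> CC (A' i)) -> d_extension CC d f ->
  d_extension CC d (fun i => to i.+1 \o f i \o fr i).
Proof.
move=> toK frK CA' [CA [wc1 wc2] [[wk0 uniq0] wk]].
have wc i : weak_cokernel CC (f i) (f i.+1) ->
    weak_cokernel CC (to i.+1 \o f i \o fr i) (to i.+2 \o f i.+1 \o fr i.+1).
  move=> [fz lift]; split=> [x /=|D CD h hf]; first by rewrite toK fz linear0.
  have [|h' h'E] := lift _ CD (h \o to i.+1).
    by move=> x; have := hf (to i x); rewrite /= toK.
  exists (h' \o fr i.+2) => x /=.
  by rewrite toK; have /= <- := h'E (fr i.+1 x); rewrite frK.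
have wker i : weak_kernel CC (f i) (f i.+1) ->
    weak_kernel CC (to i.+1 \o f i \o fr i) (to i.+2 \o f i.+1 \o fr i.+1).
  move=> [fz lift]; split=> [x /=|D CD h hf]; first by rewrite toK fz linear0.
  have [|h' h'E] := lift _ CD (fr i.+1 \o h).
    by move=> x; apply: (can_inj (toK _)); rewrite linear0; exact: hf.
  exists (to i \o h') => x /=.
  by rewrite toK; have /= <- := h'E x; rewrite frK.
split=> //; split.
- by move=> i /wc1; exact: wc.
- move=> i /wc2[/wc wci uniq]; split=> // D CD h1 h2 e x.
  rewrite -[x]frK; apply: (uniq _ CD (h1 \o to i.+2) (h2 \o to i.+2)) => y /=.
  by have := e (to i.+1 y); rewrite /= toK.
- split=> [|D CD h1 h2 e x]; first exact: wker.
  apply: (can_inj (frK _)); apply: (uniq0 _ CD (fr 0 \o h1) (fr 0 \o h2)) => y /=.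
  by apply: (can_inj (toK _)); exact: e.
by move=> i i_gt0 id; apply: wker; exact: wk.
Qed.

Lemma d_extension_sum (A A' : nat -> rmodType R)
    (f : forall i, {linear A i -> A i.+1}) (f' : forall i, {linear A' i -> A' i.+1}) :
  (forall M N, CC M -> CC N -> CC (M * N)%type) ->
  d_extension CC d f -> d_extension CC d f' ->
  @d_extension _ CC d (fun i => (A i * A' i)%type) (fun i => mklin (map_pair_linear (f i) (f' i))).
Proof.
move=> CCsum [CA [wc1 wc2] [[wk0 uniq0] wk]] [CA' [wc1' wc2'] [[wk0' uniq0'] wk']].
have wc i : weak_cokernel CC (f i) (f i.+1) -> weak_cokernel CC (f' i) (f' i.+1) ->
    weak_cokernel CC (mklin (map_pair_linear (f i) (f' i)))
      (mklin (map_pair_linear (f i.+1) (f' i.+1))).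
  move=> [fz lift] [fz' lift']; split=> [[x y]|D CD h hf].
    by rewrite /= /mklin_fun /= fz fz'.
  have [|k kE] := lift _ CD (h \o linl _ _).
    by move=> x; have := hf (x, 0); rewrite /= /mklin_fun /= linear0.
  have [|k' k'E] := lift' _ CD (h \o linr _ _).
    by move=> x; have := hf (0, x); rewrite /= /mklin_fun /= linear0.
  exists ((k \o lfst _ _) \+ (k' \o lsnd _ _)) => -[x y] /=.
  rewrite /mklin_fun /=; have /= <- := kE x; have /= <- := k'E y.
  by rewrite -linearD; congr (h (_, _)); rewrite ?addr0 ?add0r.
have wker i : weak_kernel CC (f i) (f i.+1) -> weak_kernel CC (f' i) (f' i.+1) ->
    weak_kernel CC (mklin (map_pair_linear (f i) (f' i)))
      (mklin (map_pair_linear (f i.+1) (f' i.+1))).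
  move=> [fz lift] [fz' lift']; split=> [[x y]|D CD h hf].
    by rewrite /= /mklin_fun /= fz fz'.
  have [|k kE] := lift _ CD (lfst _ _ \o h).
    by move=> x; have [] := hf x.
  have [|k' k'E] := lift' _ CD (lsnd _ _ \o h).
    by move=> x; have [] := hf x.
  exists (mklin (pair_linear k k')) => x.
  rewrite /= /mklin_fun /=; have /= <- := kE x; have /= <- := k'E x.
  by rewrite /mklin_fun; case: (h x).
split; first by move=> i id; apply: CCsum; [exact: CA | exact: CA'].
- split=> i id; first by apply: wc; [exact: wc1 | exact: wc1'].
  have [wci uniq] := wc2 _ id; have [wci' uniq'] := wc2' _ id.
  split=> [|D CD h1 h2 e [x y]]; first exact: wc.
  have pairE (h : {linear (A i.+2 * A' i.+2)%type -> D}) :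
      h (x, y) = h (linl _ _ x) + h (linr _ _ y).
    by rewrite -linearD; congr (h (_, _)); rewrite /= ?addr0 ?add0r.
  rewrite (pairE h1) (pairE h2); congr (_ + _).
    apply: (uniq _ CD (h1 \o linl _ _) (h2 \o linl _ _)) => z /=.
    by have := e (z, 0); rewrite /= /mklin_fun /= linear0.
  apply: (uniq' _ CD (h1 \o linr _ _) (h2 \o linr _ _)) => z /=.
  by have := e (0, z); rewrite /= /mklin_fun /= linear0.
split=> [|i i_gt0 id]; last by apply: wker; [exact: wk | exact: wk'].
split=> [|D CD h1 h2 e x]; first exact: wker.
have e1 := uniq0 _ CD (lfst _ _ \o h1) (lfst _ _ \o h2).
have e2 := uniq0' _ CD (lsnd _ _ \o h1) (lsnd _ _ \o h2).
rewrite [LHS]surjective_pairing [RHS]surjective_pairing; congr pair.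
  by apply: e1 => y; have [] := e y.
by apply: e2 => y; have [] := e y.
Qed.

Variable UU : modclass R.

Definition no_hom X : Prop :=
  forall M, UU M -> forall (h : {linear M -> X}) x, h x = 0.

(* A torsion sequence all of whose terms from [A 2] on are torsion free; this  *)
(* is stronger than the exactness of the [Hom] sequences.                      *)
Definition torsion_sequence C : Prop :=
  exists (A : nat -> rmodType R) (f : forall i, {linear A i -> A i.+1}),
    [/\ d_extension CC d f, UU (A 0), A 1 = C
      & forall i, (2 <= i <= d.+1)%N -> no_hom (A i)].

Lemma no_hom_exact (A : nat -> rmodType R) (f : forall i, {linear A i -> A i.+1}) U :
  (2 <= d)%N -> (forall i, (2 <= i <= d.+1)%N -> no_hom (A i)) -> UU U -> Hom_exact d f U.
Proof.
move=> d_ge2 A0 UUU; split=> [h _ x|i i_ge2 id h|h].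
- by apply: (A0 2%N _ U UUU); lia.
- have h0 := A0 i.+1 ltac:(lia) _ UUU h.
  split=> [_|_ x]; last by rewrite h0 linear0.
  by exists \0 => x; rewrite h0 /= linear0.
have dd : (2 <= d.+1 <= d.+1)%N by lia.
by exists \0 => x; rewrite (A0 _ dd _ UUU h) /= linear0.
Qed.

(** The definition asks for the equality [A 1 = C'], so that term is replaced and its adjacent maps
    are composed with the isomorphism. *)
Lemma torsion_sequence_iso C C' :
  (forall M N, isomorphic M N -> CC M -> CC N) ->
  isomorphic C C' -> torsion_sequence C -> torsion_sequence C'.
Proof.
move=> CCiso /[dup] CC' /iso_inv[t [t' [tK t'K]]] [A [f [Aext UA0 e A0]]]; subst C.
pose A' i := match i with 1 => C' | _ => A i end.
pose to i : {linear A i -> A' i} :=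
  match i return {linear A i -> A' i} with 1 => t | _ => idfun end.
pose fr i : {linear A' i -> A i} :=
  match i return {linear A' i -> A i} with 1 => t' | _ => idfun end.
exists A', (fun i => to i.+1 \o f i \o fr i); split=> //.
- apply: (d_extension_iso _ _ _ Aext); [by case=> [|[|i]] // | by case=> [|[|i]] // |].
  move=> i id; have CAi : CC (A i) by case: Aext => + _ _; exact.
  by case: i id CAi => [|[|i]] // _; exact: CCiso.
by case=> [|[|i]] //; exact: A0.
Qed.

Lemma torsion_sequence_sum C C' :
  (forall M N, CC M -> CC N -> CC (M * N)%type) ->
  (forall M N, UU M -> UU N -> UU (M * N)%type) ->
  torsion_sequence C -> torsion_sequence C' -> torsion_sequence (C * C')%type.
Proof.
move=> CCsum UUsum [A [f [Aext UA0 e A0]]] [A' [f' [Aext' UA0' e' A0']]].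
exists (fun i => (A i * A' i)%type), (fun i => mklin (map_pair_linear (f i) (f' i))).
split; [exact: d_extension_sum | exact: UUsum | by rewrite e e' |].
move=> i id M UM h x; have := A0 i id M UM (lfst _ _ \o h) x.
have := A0' i id M UM (lsnd _ _ \o h) x.
by rewrite /= /mklin_fun; case: (h x) => a b /= -> ->.
Qed.

Lemma zero_no_hom X : zero_module X -> no_hom X.
Proof. by move=> X0 M _ h x; exact: X0. Qed.

Lemma torsion_sequence_in X :
  (forall M, zero_module M -> CC M) -> CC X -> UU X -> torsion_sequence X.
Proof.
move=> CC0 CX UX.
have zero0 : zero_module (zero_mod R) by move=> x; exact: zero_modP.
pose A i := match i with 0 | 1 => X | _ => zero_mod R end.
pose f i : {linear A i -> A i.+1} :=
  match i return {linear A i -> A i.+1} with 0 => idfun | _ => \0 end.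
have A0 i : zero_module (A i.+2) by exact: zero0.
have wc i : weak_cokernel CC (f i) (f i.+1).
  split=> [x|D CD h hf]; first exact: A0.
  exists \0 => x /=; case: i h hf x => [|i] h hf x; first exact: hf.
  by rewrite (A0 _ x) linear0.
have wk i : weak_kernel CC (f i) (f i.+1).
  split=> [x|D CD h hf]; first exact: A0.
  case: i h hf => [|i] h hf; first by exists h.
  by exists \0 => x; exact: etrans (A0 i _) (esym (A0 i _)).
exists A, f; split=> //; last by case=> [|[|i]] // _; exact: zero_no_hom.
split; first by case=> [|[|i]] //= _; exact: CC0.
- split=> i _; first exact: wc.
  by split=> [|D CD h1 h2 _ x]; [exact: wc | rewrite (A0 _ x) !linear0].
split=> [|i _ _]; last exact: wk.
by split=> [|D CD h1 h2 e x]; [exact: wk | exact: e].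
Qed.

(** The identity of [X] stands between places 1 and 2; as [d] is at least 2, the last term is
    zero. *)
Lemma torsion_sequence_out X : (2 <= d)%N ->
  (forall M, zero_module M -> CC M) -> (forall M, zero_module M -> UU M) ->
  CC X -> no_hom X -> torsion_sequence X.
Proof.
move=> d_ge2 CC0 UU0 CX X0.
have zero0 : zero_module (zero_mod R) by move=> x; exact: zero_modP.
pose A i := match i with 1 | 2 => X | _ => zero_mod R end.
pose f i : {linear A i -> A i.+1} :=
  match i return {linear A i -> A i.+1} with 1 => idfun | _ => \0 end.
have A0 i : zero_module (A i.+3) by exact: zero0.
have fz i x : f i.+1 (f i x) = 0 by case: i x => [|[|i]].
have wc i : weak_cokernel CC (f i) (f i.+1).
  split=> // D CD h hf.
  case: i h hf => [|[|i]] h hf; first by exists h.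
    by exists \0 => x; exact: hf.
  by exists \0 => x; rewrite (A0 _ x) !linear0.
have wk i : weak_kernel CC (f i) (f i.+1).
  split=> // D CD h hf.
  case: i h hf => [|[|i]] h hf; first by exists \0 => x; exact: hf.
    by exists h.
  by exists \0 => x; exact: A0.
exists A, f; split=> //; first last.
- by case=> [|[|[|i]]] // _; exact: zero_no_hom.
- exact: UU0.
split; first by case=> [|[|[|i]]] //= _; exact: CC0.
- split=> i id; first exact: wc.
  split=> [|D CD h1 h2 _ x]; first exact: wc.
  by case: i id h1 h2 x => [|i] id h1 h2 x; [lia | rewrite (A0 _ x) !linear0].
split=> [|i _ _]; last exact: wk.
by split=> [|D CD h1 h2 _ x]; [exact: wk | exact: zero_modP].
Qed.

End ExtensionOperations.

Section HomZero.
Variables (F : fieldType) (n : nat).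
Local Notation L := (Lambda F n).
Implicit Types (i j : 'I_n) (k l : 'I_n.-1).

Lemma hom_SS i j (h : {linear Smod F i -> Smod F j}) : i != j -> forall x, h x = 0.
Proof.
move=> ij x; rewrite homS (_ : h (1 : F) = 0) ?scaler0 //.
by rewrite -homS_ev SactE lcoefE eq_sym (negPf ij) mulr0.
Qed.

Lemma hom_SI i k (h : {linear Smod F i -> Imod F k}) : i != lo k -> forall x, h x = 0.
Proof.
move=> ik x; rewrite homS (_ : h (1 : F) = 0) ?scaler0 //.
have := homS_ev h; have := homS_aout h.
case: (h (1 : F)) => a b; rewrite !IactE !lcoefE ?unitalE /=.
rewrite [lo k == i]eq_sym (negPf ik) !mulr0 => -[] + [<- <-].
by case: eqP => [_|_]; rewrite ?mulr0 // !mulr1 => ->.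
Qed.

Lemma hom_IS k i (h : {linear Imod F k -> Smod F i}) : hi k != i -> forall x, h x = 0.
Proof.
move=> ki x; rewrite homI (_ : h (1, 0) = 0) ?fromIE ?scaler0 //.
by rewrite homI_gen SactE lcoefE eq_sym (negPf ki) mulr0.
Qed.

Lemma hom_II k l (h : {linear Imod F k -> Imod F l}) :
  k != l -> hi k != lo l -> forall x, h x = 0.
Proof.
move=> kl kl' x; rewrite homI (_ : h (1, 0) = 0) ?fromIE ?scaler0 //.
rewrite homI_gen IactE !lcoefE (inj_eq (@hi_inj n)) eq_sym (negPf kl).
by rewrite [lo l == _]eq_sym (negPf kl') !mulr0 addr0.
Qed.

End HomZero.

Section StandardMaps.
Variables (F : fieldType) (n d : nat) (CC : modclass (Lambda F n)).
Hypothesis d_ge2 : (2 <= d)%N.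
Hypothesis CC_ct : cluster_tilting d CC.
Local Notation L := (Lambda F n).
Local Notation ev := (@ev F n).
Local Notation ea := (@ea F n).
Local Notation ain := (@ain F n).
Local Notation aout := (@aout F n).
Implicit Types (i j : 'I_n) (k l : 'I_n.-1) (D X Y : rmodType L).

(** A map killing the socle sends the generator to a cycle at [hi k]; members of [CC] are exact
    there, so it is a boundary and defines the factor on [Imod F l]. *)
Lemma step_weak_cokernel X k l (phi : {linear X -> Imod F k}) (e : hi k = lo l) :
  (exists x, phi x = (0, 1)) -> (forall x, (phi x).1 = 0) -> ~~ (d %| hi k)%N ->
  weak_cokernel CC phi (step_I F e).
Proof.
move=> [x0 phix0] phi1 dk; split=> [x|D CD h hphi].
  by rewrite /= /mklin_fun phi1.
have [||y yE] := @ct_exact _ _ _ CC d_ge2 CC_ct (hi k) _ dk CD (h (1, 0)).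
- by rewrite -homI_gen.
- by rewrite aout_hi -homI_soc -phix0 hphi.
exists (fromI l y) => v; apply: (homI_eq (g := fromI l y \o step_I F e)).
by rewrite yE e ain_lo; exact/esym/fromI_soc.
Qed.

Lemma top_cokernel X k i (phi : {linear X -> Imod F k}) (e : hi k = i) :
  (exists x, phi x = (0, 1)) -> (forall x, (phi x).1 = 0) ->
  cokernel CC phi (top_I F e).
Proof.
move=> [x0 phix0] phi1; subst i; split=> [|D CD h1 h2 e x].
  split=> [x|D CD h hphi]; first by rewrite /= /mklin_fun phi1.
  have xo : aout (hi k) *: h (1, 0) = 0 by rewrite aout_hi -homI_soc -phix0 hphi.
  exists (fromS (esym (homI_gen h)) xo) => v.
  apply: (homI_eq (g := fromS (esym (homI_gen h)) xo \o top_I F (erefl (hi k)))).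
  by rewrite -[LHS](fromS1 (esym (homI_gen h)) xo).
exact: (e (x, 0)).
Qed.

Lemma soc_kernel Y k i (psi : {linear Imod F k -> Y}) (e : i = lo k) :
  (forall v, psi v = 0 <-> v.1 = 0) -> kernel CC (soc_I F e) psi.
Proof.
move=> psi0; subst i; split=> [|D CD h1 h2 e x]; last by have [] := e x.
split=> [v|D CD h hpsi]; first by apply/psi0.
have h1 y : (h y).1 = 0 by apply/psi0.
have hL : linear ((fun y => (h y).2) : D -> Smod F (lo k)).
  by move=> c x y; rewrite linearP SactE /= h1 mul0r add0r.
exists (mklin hL) => y; rewrite /= /mklin_fun /= -(h1 y).
by case: (h y).
Qed.

(** Dually, the socle coordinate of [h] is a functional that, by exactness at [hi k], vanishes where
    the arrow [k] does; factored through that arrow, it gives a map to [Imod F k]. *)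
Lemma step_weak_kernel Y k l (psi : {linear Imod F l -> Y}) (e : hi k = lo l) :
  (forall v, psi v = 0 <-> v.1 = 0) -> ~~ (d %| hi k)%N ->
  weak_kernel CC (step_I F e) psi.
Proof.
move=> psi0 dk; split=> [v|D CD h hpsi]; first by apply/psi0.
have h1 y : (h y).1 = 0 by apply/psi0.
pose phi y := (h y).2.
have phiE c y : phi (c *: y) = phi y * cv c (lo l).
  by rewrite /phi linearZ /= h1 mul0r add0r.
have phiL : Flin phi.
  by move=> r x y; rewrite /phi linearD /= -/(phi _) phiE lcoefE mulrC.
have [x x0|psi' psi'L psi'E] := functional_factor (c := ea k) (ct_fg CC_ct CD) phiL.
  have xv : phi x = phi (ev (hi k) *: x) by rewrite phiE lcoefE e eqxx mulr1.
  have [||y yE] := @ct_exact _ _ _ CC d_ge2 CC_ct (hi k) _ dk CD (ev (hi k) *: x).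
  - exact: ev_ev.
  - by rewrite aout_hi ea_ev.
  by rewrite xv yE phiE lcoefE mulr0.
exists (toI psi'L k) => y; rewrite /= /mklin_fun /= -psi'E -(h1 y).
by rewrite /phi; case: (h y).
Qed.

(** Codes let the terms of a sequence be computed from the position, with [cmap] supplying all maps
    by cases and [0] where indices do not match. *)
Variant ind := IS of 'I_n | II of 'I_n.-1.

Definition mod_of (a : ind) : rmodType L :=
  match a with IS i => Smod F i | II k => Imod F k end.

Definition cmap (a b : ind) : {linear mod_of a -> mod_of b} :=
  match a, b return {linear mod_of a -> mod_of b} with
  | IS i, II k => if @eqP _ i (lo k) is ReflectT e then soc_I F e else \0
  | II k, IS i => if @eqP _ (hi k) i is ReflectT e then top_I F e else \0
  | II k, II l => if @eqP _ (hi k) (lo l) is ReflectT e then step_I F e else \0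
  | IS _, IS _ => \0
  end.

Lemma cmap_SI i k (e : i = lo k) : cmap (IS i) (II k) = soc_I F e.
Proof. by rewrite /cmap; case: eqP => // e'; rewrite (eq_irrelevance e' e). Qed.
Lemma cmap_IS i k (e : hi k = i) : cmap (II k) (IS i) = top_I F e.
Proof. by rewrite /cmap; case: eqP => // e'; rewrite (eq_irrelevance e' e). Qed.
Lemma cmap_II k l (e : hi k = lo l) : cmap (II k) (II l) = step_I F e.
Proof. by rewrite /cmap; case: eqP => // e'; rewrite (eq_irrelevance e' e). Qed.

(* [S(i0) -> I(i0) -> I(i0+1) -> ... -> I(i0+d-1) -> S(i1)], with [i1 = i0+d]. *)
Section Sequence.
Variables i0 i1 : 'I_n.
Hypothesis i1E : i1 = (i0 + d)%N :> nat.

(** Position [m.+1] carries the arrow [i0 + m]; by [seq_arrow] the fallback for a failing [insub]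
    does not occur. *)
Definition seq_idx (m : nat) : ind :=
  if m is m'.+1 then
    if (m' < d)%N then
      if insub (i0 + m')%N is Some k then II k else IS i0
    else IS i1
  else IS i0.

Lemma seq_arrow m : (m < d)%N -> exists k : 'I_n.-1, k = (i0 + m)%N :> nat.
Proof.
move=> md; have lt : (i0 + m < n.-1)%N by have := ltn_ord i1; lia.
by exists (Ordinal lt).
Qed.

Lemma seq_idx_mid m k : (m < d)%N -> k = (i0 + m)%N :> nat -> seq_idx m.+1 = II k.
Proof. by move=> md kE; rewrite /= md -kE valK. Qed.

Lemma seq_idx_last : seq_idx d.+1 = IS i1.
Proof. by rewrite /= ltnn. Qed.

Lemma seq_map_in m k : (m < d)%N -> k = (i0 + m)%N :> nat ->
  (exists x, cmap (seq_idx m) (II k) x = (0, 1)) /\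
  (forall x, (cmap (seq_idx m) (II k) x).1 = 0).
Proof.
case: m => [|m] md kE.
  have e : i0 = lo k by apply: val_inj; rewrite /= kE addn0.
  by rewrite (cmap_SI e); split=> //; exists (1 : F).
have [l lE] := seq_arrow (ltnW md).
have e : hi l = lo k by apply: val_inj; rewrite /= kE lE addnS.
rewrite (seq_idx_mid (ltnW md) lE) (cmap_II e); split=> //.
by exists (1, 0).
Qed.

Lemma seq_map_out m k : (m < d)%N -> k = (i0 + m)%N :> nat ->
  forall v, cmap (II k) (seq_idx m.+2) v = 0 <-> v.1 = 0.
Proof.
move=> md kE v; have [em|mSd] := eqVneq m.+1 d.
  have e : hi k = i1 by apply: val_inj; rewrite /= kE i1E -em addnS.
  by rewrite em seq_idx_last (cmap_IS e).
have md' : (m.+1 < d)%N by lia.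
have [l lE] := seq_arrow md'.
have e : hi k = lo l by apply: val_inj; rewrite /= kE lE addnS.
rewrite (seq_idx_mid md' lE) (cmap_II e) /= /mklin_fun.
by split=> [[]|->].
Qed.

Hypothesis di0 : (d %| i0)%N.

Lemma seq_ndvd m k : (m.+1 < d)%N -> k = (i0 + m)%N :> nat -> ~~ (d %| hi k)%N.
Proof.
move=> md kE; rewrite /= kE -addnS dvdn_addr //.
by apply/negP => /dvdn_leq; lia.
Qed.

Lemma seq_extension :
  @d_extension _ CC d (fun m => mod_of (seq_idx m))
    (fun m => cmap (seq_idx m) (seq_idx m.+1)).
Proof.
split.
- move=> [_|m]; first exact: (ct_S d_ge2 CC_ct).
  rewrite ltnS leq_eqVlt => /predU1P[->|md].
    rewrite seq_idx_last; apply: (ct_S d_ge2 CC_ct).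
    by rewrite i1E dvdn_addr // dvdnn.
  have [k kE] := seq_arrow md; rewrite (seq_idx_mid md kE).
  exact: ct_I CC_ct k.
- split=> m md.
    have [k kE] := seq_arrow (ltnW md); have [l lE] := seq_arrow md.
    have e : hi k = lo l by apply: val_inj; rewrite /= kE lE addnS.
    have [in1 in2] := seq_map_in (ltnW md) kE.
    rewrite (seq_idx_mid md lE) (seq_idx_mid (ltnW md) kE) (cmap_II e).
    exact: step_weak_cokernel in1 in2 (seq_ndvd md kE).
  have md' : (m < d)%N by lia.
  have [k kE] := seq_arrow md'; have [in1 in2] := seq_map_in md' kE.
  have e : hi k = i1 by apply: val_inj; rewrite /= kE i1E -md addnS.
  rewrite (_ : seq_idx m.+2 = IS i1); last by rewrite md seq_idx_last.
  rewrite (seq_idx_mid md' kE) (cmap_IS e).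
  exact: top_cokernel.
have d_gt0 : (0 < d)%N by lia.
split=> [|[//|m] _ md].
  have [k kE] := seq_arrow d_gt0.
  have e : i0 = lo k by apply: val_inj; rewrite /= kE addn0.
  have := seq_map_out d_gt0 kE.
  rewrite (seq_idx_mid d_gt0 kE) [seq_idx 0]/= (cmap_SI e).
  exact: soc_kernel.
have [k kE] := seq_arrow (ltnW md); have [l lE] := seq_arrow md.
have e : hi k = lo l by apply: val_inj; rewrite /= kE lE addnS.
have := seq_map_out md lE.
rewrite (seq_idx_mid md lE) (seq_idx_mid (ltnW md) kE) (cmap_II e) => out.
exact: step_weak_kernel out (seq_ndvd md kE).
Qed.

End Sequence.

End StandardMaps.

(** * Path subcategories are torsion classes *)

Section PathTorsion.
Variables (F : fieldType) (n d p : nat) (CC : modclass (Lambda F n)).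
Hypothesis d_ge2 : (2 <= d)%N.
Hypothesis p_ge1 : (1 <= p)%N.
Hypothesis n_eq : n = ((p - 1) * d + 1)%N.
Hypothesis CC_ct : cluster_tilting d CC.
Variable chi : Gwalk d p.
Hypothesis chiP : Gpath chi.
Local Notation L := (Lambda F n).
Local Notation UU := (U_of F n chi).
Local Notation Q := (Q_ n chi).
Implicit Types (i : 'I_n) (k l : 'I_n.-1) (M X : rmodType L).

Lemma ct_additive : additive_class CC.
Proof.
split; [exact: ct_iso CC_ct | exact: ct_zero CC_ct | exact: ct_sum CC_ct |].
move=> M N; apply: (ct_retract CC_ct).
by exists (linl M N), (lfst M N).
Qed.

Lemma U_sub M : UU M -> CC M.
Proof.
apply: U_min => [|j i _ iE|k _].
- exact: ct_additive.
- by apply: (ct_S d_ge2 CC_ct); rewrite iE dvdn_mull.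
exact: ct_I CC_ct k.
Qed.

Lemma no_hom_min X :
  (forall (j : 'I_p) i, chi.1 j = DD -> i = (j * d)%N :> nat ->
     forall (h : {linear Smod F i -> X}) x, h x = 0) ->
  (forall k, k \in Q -> forall (h : {linear Imod F k -> X}) x, h x = 0) ->
  no_hom UU X.
Proof.
move=> XS XI M.
by apply: (U_min (P := fun M => forall (h : {linear M -> X}) x, h x = 0));
  first exact: additive_no_hom.
Qed.

Lemma no_hom_S (j : 'I_p) i : i = (j * d)%N :> nat -> chi.1 j <> DD ->
  no_hom UU (Smod F i).
Proof.
move=> iE Vj; have [P1 _ _] := path_profile d_ge2 n_eq chiP.
apply: no_hom_min => [j' i' Vj' i'E h|k kQ h].
  apply: hom_SS; apply/eqP => ii'; subst i'.
  suff jj' : j = j' by rewrite jj' in Vj.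
  apply: val_inj; apply/eqP; rewrite -(eqn_pmul2r (m := d)) /= -?iE ?i'E //.
  exact: ltnW.
by apply: hom_IS; apply/eqP => kE; apply: Vj; apply: (P1 _ kQ); rewrite -iE -kE.
Qed.

(** Nonzero maps could come only from the simple at [lo l], from [Imod F l], or from the preceding
    [Imod]. The last would put [l] in [Q], or, when [d] divides [l], make the vertex there [DD]. *)
Lemma no_hom_I l : l \notin Q ->
  (forall j : 'I_p, l = (j * d)%N :> nat -> chi.1 j <> DD) ->
  no_hom UU (Imod F l).
Proof.
move=> lQ Vl; have [P1 P2 _] := path_profile d_ge2 n_eq chiP.
apply: no_hom_min => [j i Vj iE h|k kQ h].
  apply: hom_SI; apply/eqP => il; apply: (Vl j) => //.
  by rewrite -iE il.
apply: hom_II; first by apply: contraNneq lQ => <-.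
apply: contraNneq lQ => kl.
have lE : l = k.+1 :> nat by rewrite -[RHS]/(hi k : nat) kl.
apply: (P2 _ _ kQ lE); apply/negP => /dvdnP[q qE].
have l_lt := ltn_ord l.
have q_lt : (q < p)%N.
  have : (q * d < (p - 1) * d)%N by lia.
  by rewrite ltn_pmul2r; lia.
apply: (Vl (Ordinal q_lt)) => //.
by apply: (P1 _ kQ); rewrite -lE.
Qed.

Lemma torsion_sequence_S i : CC (Smod F i) -> torsion_sequence CC d UU (Smod F i).
Proof.
move=> Ci; have /dvdnP[q iE] := ct_S_dvd d_ge2 CC_ct Ci.
have i_lt := ltn_ord i.
have q_lt : (q < p)%N.
  have : (q * d < p * d)%N by nia.
  by rewrite ltn_pmul2r; lia.
case Vq: (chi.1 (Ordinal q_lt)).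
  apply: torsion_sequence_out => //; first exact: ct_zero CC_ct.
    exact: addc_zero (U_additive F n chi).
  by apply: (no_hom_S (j := Ordinal q_lt)); rewrite ?Vq.
apply: torsion_sequence_in => //; first exact: ct_zero CC_ct.
exact: U_S Vq iE.
Qed.

(** A proper nonzero torsion part occurs only if [k] starts a block with [DD] at its start but not
    at its end. The arrow is then [Beta], the block misses [Q], and all later terms of the sequence
    are torsion free. *)
Lemma torsion_sequence_I k : torsion_sequence CC d UU (Imod F k).
Proof.
have Ck := ct_I CC_ct k.
have [kQ|kQ] := boolP (k \in Q).
  apply: torsion_sequence_in => //; first exact: ct_zero CC_ct.
  exact: U_I.
have [[q [kE Vq]]|none] := classic (exists q : 'I_p, k = (q * d)%N :> nat /\ chi.1 q = DD);
    last first.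
  apply: torsion_sequence_out => //; first exact: ct_zero CC_ct.
    exact: addc_zero (U_additive F n chi).
  by apply: no_hom_I => // j kE Vj; apply: none; exists j.
have [j jk] := block_ex d_ge2 n_eq k.
have qj : q = lo j by apply: val_inj => /=; move: jk; rewrite kE; nia.
subst q; have [_ _ P3] := path_profile d_ge2 n_eq chiP.
have Vhi : chi.1 (hi j) <> DD.
  by move=> Vhi; rewrite (P3 j k) in kQ.
have [jsrc jtgt] := chiP j; rewrite Vq in jsrc.
have j_lt := ltn_ord j.
have blockQ l : (j * d <= l < j.+1 * d)%N -> l \notin Q.
  move=> lj; rewrite (QP d_ge2 chi lj).
  by case: (chi.2 j) jsrc jtgt => //= _ e; case: Vhi.
have i1_lt : (j.+1 * d < n)%N.
  have : (j.+1 * d <= p.-1 * d)%N by rewrite leq_mul2r j_lt orbT.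
  by rewrite n_eq subn1; lia.
have jdS : (j.+1 * d = j * d + d)%N by rewrite mulSn addnC.
have dk : (d %| lo k)%N by rewrite /= kE dvdn_mull.
have i1E : Ordinal i1_lt = (lo k + d)%N :> nat by rewrite /= kE jdS.
have ext := seq_extension d_ge2 CC_ct i1E dk.
exists (fun m => mod_of F (seq_idx d (lo k) (Ordinal i1_lt) m)).
exists (fun m => cmap F (seq_idx d (lo k) (Ordinal i1_lt) m)
                        (seq_idx d (lo k) (Ordinal i1_lt) m.+1)).
split=> //.
- by apply: (@U_S F n d p chi (lo j) (lo k)).
- rewrite (_ : seq_idx _ _ _ 1 = II k) //.
  by apply: seq_idx_mid; rewrite /= ?addn0 //; lia.
case=> [|[|m]] // /andP[_ md] /=.
have [e|mSd] := eqVneq m.+1 d.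
  rewrite (_ : (m.+1 < d)%N = false) ?e ?ltnn //.
  by apply: (no_hom_S (j := hi j)).
have md' : (m.+1 < d)%N by lia.
have [l lE] := seq_arrow d_ge2 i1E md'; rewrite md' -lE valK /=.
move: lE => /= lE; apply: no_hom_I.
  by rewrite /= in kE; apply: blockQ; lia.
move=> q lqE; exfalso.
have : (d %| m.+1)%N.
  by rewrite -(dvdn_addr m.+1 (dvdn_mull j (dvdnn d))) -kE -lE lqE dvdn_mull.
by move=> /dvdn_leq; lia.
Qed.

Lemma path_torsion : d_torsion d CC UU.
Proof.
have Ua := U_additive F n chi; split.
- split.
  + by move=> M /U_sub; exact: (ct_fg CC_ct).
  + exact: addc_iso.
  + exact: addc_zero.
  + exact: addc_sum.
- exact: U_sub.
have CCiso := ct_iso CC_ct; have CCzero := ct_zero CC_ct; have CCsum := ct_sum CC_ct.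
have tor C : CC C -> torsion_sequence CC d UU C.
  apply: (module_ind (P := torsion_sequence CC d UU)).
  - exact: (ct_fg CC_ct).
  - exact: (ct_retract CC_ct).
  - by move=> M N; exact: torsion_sequence_iso.
  - move=> M M0; apply: torsion_sequence_in => //; first exact: CCzero.
    exact: addc_zero.
  - by move=> M N _; apply: torsion_sequence_sum => //; exact: addc_sum.
  - exact: torsion_sequence_S.
  by move=> k _; exact: torsion_sequence_I.
move=> C /tor[A [f [Aext UA0 e A0]]]; exists A, f; split=> // U UU'.
exact: (no_hom_exact f d_ge2 A0 UU').
Qed.

End PathTorsion.

(* The bijection *)
Close Scope ring_scope.

Theorem theorem4p21 (F : fieldType) (n d p : nat) (CC : modclass (Lambda F n))
    (n_ge1 : 1 <= n) (d_ge2 : 2 <= d) (p_ge1 : 1 <= p)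
    (n_eq : n = (p - 1) * d + 1)
    (CC_ct : cluster_tilting d CC) :
  [/\ forall chi : Gwalk d p, Gpath chi -> d_torsion d CC (U_of F n chi),
      forall chi chi' : Gwalk d p, Gpath chi -> Gpath chi' ->
        (forall M, U_of F n chi M <-> U_of F n chi' M) -> chi = chi'
    & forall UU : modclass (Lambda F n), d_torsion d CC UU ->
        exists2 chi : Gwalk d p, Gpath chi &
          forall M, U_of F n chi M <-> UU M].
Proof.
have d_gt0 : (0 < d)%N by exact: ltnW.
have vtx (j : 'I_p) : (j * d < n)%N.
  have : (j * d <= p.-1 * d)%N by rewrite leq_mul2r; have := ltn_ord j; lia.
  by rewrite n_eq subn1; lia.
split=> [chi chiP|chi chi' chiP chi'P UU'|UU UUt].
- exact: path_torsion.
- apply: (path_inj d_ge2 n_eq) => // [j|].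
    case Vj: (chi.1 j); case V'j: (chi'.1 j) => //.
      have := U_S F V'j (erefl : Ordinal (vtx j) = (j * d)%N :> nat).
      by move=> /UU'/(U_S_inv d_gt0)/(_ erefl); rewrite Vj.
    have := U_S F Vj (erefl : Ordinal (vtx j) = (j * d)%N :> nat).
    by move=> /UU'/(U_S_inv d_gt0)/(_ erefl); rewrite V'j.
  by apply/setP => k; apply/idP/idP => /(U_I F)/UU'/U_I_inv.
(* Finite choice with classical decisions: [V] and [b] record which of the modules [Smod] and [Imod]
   lie in [UU]. *)
have [V VP] : exists V : 'I_p -> Gvertex,
    forall j, V j = DD <-> UU (Smod F (Ordinal (vtx j))).
  apply: (fin_all_exists (P := fun j v => v = DD <-> UU (Smod F (Ordinal (vtx j))))) => j.
  have [Uj|nUj] := classic (UU (Smod F (Ordinal (vtx j)))); first by exists DD.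
  by exists Ddown0; split.
have [b bP] : exists b : 'I_n.-1 -> bool, forall k, b k <-> UU (Imod F k).
  apply: (fin_all_exists (P := fun k (b : bool) => b <-> UU (Imod F k))) => k.
  have [Uk|nUk] := classic (UU (Imod F k)); first by exists true.
  by exists false; split.
have [chi chiP [chiV chiQ]] : exists2 chi : Gwalk d p, Gpath chi &
    chi.1 =1 V /\ Q_ n chi = [set k | b k].
  apply: (profile_path d_ge2 n_eq); split.
  - move=> k; rewrite inE => /bP Uk j kE; apply/VP.
    rewrite (_ : Ordinal (vtx j) = hi k); last by apply: val_inj; rewrite /= kE.
    by apply: (tor_top d_ge2 CC_ct UUt Uk); rewrite kE dvdn_mull.
  - move=> k l; rewrite !inE => /bP Uk lE dl; apply/bP.
    exact: (tor_step d_ge2 CC_ct UUt Uk lE dl).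
  move=> j k /VP U0 /VP U1 kE; rewrite inE; apply/bP.
  apply: (tor_socle d_ge2 CC_ct UUt U0 U1).
  - by rewrite /= dvdn_mull.
  - by rewrite /= mulSn addnC.
  by apply: val_inj.
exists chi => // M; have UUa := tor_additive d_ge2 CC_ct UUt.
split=> [|UM].
  apply: U_min => // [j i Vj iE|k kQ].
    rewrite (_ : i = Ordinal (vtx j)); last by apply: val_inj.
    by apply/VP; rewrite -chiV.
  by apply/bP; move: kQ; rewrite chiQ inE.
have tor_CC := @tor_sub _ _ _ _ _ UUt.
(* The induction stays inside [UU], whose simples and [Imod]'s are exactly those recorded by [V] and
   [b]. *)
apply: (module_ind (C := UU)) UM.
- by move=> N /tor_CC; exact: (ct_fg CC_ct).
- exact: (tor_retract d_ge2 CC_ct UUt).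
- exact: addc_iso (U_additive F n chi).
- exact: addc_zero (U_additive F n chi).
- by move=> N N' _; exact: addc_sum (U_additive F n chi) _ _.
- move=> i Ui; have /dvdnP[q iE] := ct_S_dvd d_ge2 CC_ct (tor_CC _ Ui).
  have i_lt := ltn_ord i.
  have q_lt : (q < p)%N.
    have : (q * d < p * d)%N by nia.
    by rewrite ltn_pmul2r.
  apply: (@U_S F n d p chi (Ordinal q_lt)) => //; rewrite chiV; apply/VP.
  by rewrite (_ : Ordinal _ = i) //; apply: val_inj.
by move=> k Uk; apply: U_I; rewrite chiQ inE; apply/bP.
Qed.
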